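(* Let $\ell\ge 0$ be an integer, $\kappa\in\mathbb{R}$ and $c\in\mathbb{R}_+=\{c\in\mathbb R: c>0\}$. Let $(\pi_\kappa,\mathcal{V}_\kappa^\vee\otimes\mathcal{V}_\kappa)$ be the one-dimensional representation of $GL_{\ell+1}(\mathbb{R})\times GL_{\ell+1}(\mathbb{R})$ given by $$(g_1,g_2)\longmapsto |\det(g_1^{-1}g_2)|^{\imath\kappa},$$ let $\mathcal{W}_c$ be the irreducible representation of the Heisenberg Lie algebra $\mathcal{H}^{(\ell+1)}$ in which the central element $C$ acts by $\imath c$, and let $(\pi_{\kappa,c},\mathcal{V}_{\kappa,c})$ be the irreducible $\mathcal{H}GL_{\ell+1}$-module with representation space $\mathcal{V}_{\kappa,c}\simeq\mathcal{V}_\kappa^\vee\otimes\mathcal{V}_\kappa\otimes\mathcal{W}_c$ described in the context. Then the $GL_{\ell+1}(\mathbb{R})$ Hecke-Baxter function $$Q_{s,c}(g)=|\det(g)|^{s+\frac{\ell}{2}}\,e^{-\frac{1}{2c}\mathrm{Tr}(g^\top g)}$$ allows the following $\mathcal{H}GL_{\ell+1}$ matrix element representation: $$Q_{s,c}(g)=\langle\psi,\ \pi_{\kappa,c}(1,g)\,\phi\rangle,\qquad s=\imath\kappa+\tfrac12,\qquad g\in GL_{\ell+1}(\mathbb{R}),$$ where $\phi\in\mathcal V_{\kappa,c}$ is the spherical vector and $\psi\in\mathcal V_{\kappa,c}^\vee$ is the Whittaker vector defined in the context.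
   Context: $\imath=\sqrt{-1}$; $\mathrm{Mat}_{\ell+1}$ is the space of real $(\ell+1)\times(\ell+1)$ matrices; $g^\top$ is the transpose. **Lie algebra.** $\mathcal{H}^{(\ell+1)}$ is the Heisenberg Lie algebra with generators $X_{ij},Y_{ij}$ ($1\le i,j\le \ell+1$) and central element $C$, with $[X_{ij},X_{kl}]=[Y_{ij},Y_{kl}]=0$ and $[X_{ij},Y_{kl}]=C\,\delta_{ik}\delta_{jl}$. The Lie algebra $\mathfrak{hgl}_{\ell+1}=(\mathfrak{gl}_{\ell+1}\oplus\mathfrak{gl}_{\ell+1})\ltimes\mathcal{H}^{(\ell+1)}$ has the additional generators $e^L_{ij}$, $e^R_{ij}$ (standard generators of the first and the second copy of $\mathfrak{gl}_{\ell+1}$), with relations $[e^{L,R}_{ij},e^{L,R}_{kl}]=\delta_{jk}e^{L,R}_{il}-\delta_{il}e^{L,R}_{kj}$, $[e^L_{ij},e^R_{kl}]=0$, $[e^{L,R}_{ij},C]=0$, $[e^L_{ij},X_{kl}]=-\delta_{ik}X_{jl}$, $[e^L_{ij},Y_{kl}]=\delta_{jk}Y_{il}$, $[e^R_{ij},X_{kl}]=\delta_{jl}X_{ki}$, $[e^R_{ij},Y_{kl}]=-\delta_{il}Y_{kj}$. $\mathcal{H}GL_{\ell+1}$ is the corresponding Lie group, the extension of $GL_{\ell+1}(\mathbb{R})\times GL_{\ell+1}(\mathbb{R})$ by the Heisenberg Lie group; $(g_1,g_2)$ denotes an element of its subgroup $GL_{\ell+1}(\mathbb{R})\times GL_{\ell+1}(\mathbb{R})$.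 **Representation.** $\mathcal{W}_c$ is realized in the space $\mathcal{S}(\mathrm{Mat}_{\ell+1})$ of Schwartz functions of $x=(x_{ij})\in\mathrm{Mat}_{\ell+1}$. Identifying the one-dimensional space $\mathcal{V}_\kappa^\vee\otimes\mathcal{V}_\kappa$ with $\mathbb{C}$, the representation $\pi_{\kappa,c}$ acts on $\mathcal{V}_{\kappa,c}=\mathcal{S}(\mathrm{Mat}_{\ell+1})$ by $\pi_{\kappa,c}(X_{ij})=\imath x_{ij}$, $\pi_{\kappa,c}(Y_{ij})=-c\,\partial/\partial x_{ij}$, $\pi_{\kappa,c}(C)=\imath c$, $\pi_{\kappa,c}(e^L_{ij})=-\sum_{k}x_{jk}\frac{\partial}{\partial x_{ik}}-\frac{\ell+1}{2}\delta_{ij}-\imath\kappa\,\delta_{ij}$, $\pi_{\kappa,c}(e^R_{ij})=\sum_{k}x_{ki}\frac{\partial}{\partial x_{kj}}+\frac{\ell+1}{2}\delta_{ij}+\imath\kappa\,\delta_{ij}$. The action of $\mathfrak{gl}_{\ell+1}\oplus\mathfrak{gl}_{\ell+1}$ is integrated to the group action $$(\pi_{\kappa,c}(g_1,g_2)f)(x)=|\det(g_1^{-1}g_2)|^{\imath\kappa+\frac{\ell+1}{2}}\,f(g_1^{-1}xg_2).$$ **Pairing.** The contragredient representation $\pi^\vee_{\kappa,c}$ acts on the space $\mathcal{V}_{\kappa,c}^\vee$ of tempered distributions on $\mathrm{Mat}_{\ell+1}$. The pairing is $\langle\chi_1,\chi_2\rangle=\int_{\mathrm{Mat}_{\ell+1}}\overline{\chi_1(x)}\,\chi_2(x)\prod_{i,j}dx_{ij}$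 (understood distributionally), and $\langle\chi_1,\pi_{\kappa,c}(U)\chi_2\rangle=-\langle\pi^\vee_{\kappa,c}(U)\chi_1,\chi_2\rangle$ for $U\in\mathfrak{hgl}_{\ell+1}$. **Vectors.** The spherical vector is $\phi(x)=e^{-\frac{1}{2c}\mathrm{Tr}(x^\top x)}$; it satisfies $\pi_{\kappa,c}(X_{ij})\phi=\imath\,\pi_{\kappa,c}(Y_{ij})\phi$ and $\pi_{\kappa,c}(e^{L,R}_{ij}-e^{L,R}_{ji})\phi=0$. The Whittaker vector is the tempered distribution $\psi(x)=\prod_{i,j=1}^{\ell+1}\delta(x_{ij}-\delta_{ij})$, i.e. the delta distribution at the identity matrix; it satisfies $\pi^\vee_{\kappa,c}(X_{ij})\psi=\imath\delta_{ij}\psi$ and $\pi^\vee_{\kappa,c}(e^L_{ij}+e^R_{ij})\psi=0$. (The factors of $\phi$ and $\psi$ in $\mathcal{V}_\kappa^\vee\otimes\mathcal{V}_\kappa\simeq\mathbb{C}$ are normalized to be $1$.) *)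

(* Defs.v *)
From HB Require Import structures.
From mathcomp Require Import all_boot all_order all_algebra.
From mathcomp Require Import all_classical all_reals all_analysis.
From mathcomp Require Export complex.

Set Implicit Arguments.
Unset Strict Implicit.
Unset Printing Implicit Defensive.

Import Order.TTheory GRing.Theory Num.Theory.
Import numFieldNormedType.Exports.

Local Open Scope classical_set_scope.
Local Open Scope ring_scope.
Local Open Scope complex_scope.

Inductive hgl_gen (l : nat) : Type :=
| genL of 'I_l.+1 & 'I_l.+1
| genR of 'I_l.+1 & 'I_l.+1
| genX of 'I_l.+1 & 'I_l.+1
| genY of 'I_l.+1 & 'I_l.+1
| genC.
Arguments genC {l}.

Section HglGenFinite.
Variable l : nat.
Local Notation I2 := ('I_l.+1 * 'I_l.+1)%type.

Definition hgl_gen_code (w : hgl_gen l) : (I2 + I2) + (I2 + I2) + unit :=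
  match w with
  | genL i j => inl (inl (inl (i, j)))
  | genR i j => inl (inl (inr (i, j)))
  | genX i j => inl (inr (inl (i, j)))
  | genY i j => inl (inr (inr (i, j)))
  | genC => inr tt
  end.

Definition hgl_gen_decode (w : (I2 + I2) + (I2 + I2) + unit) : hgl_gen l :=
  match w with
  | inl (inl (inl p)) => genL p.1 p.2
  | inl (inl (inr p)) => genR p.1 p.2
  | inl (inr (inl p)) => genX p.1 p.2
  | inl (inr (inr p)) => genY p.1 p.2
  | inr _ => genC
  end.

Lemma hgl_gen_codeK : cancel hgl_gen_code hgl_gen_decode.
Proof. by case. Qed.

HB.instance Definition _ := Finite.copy (hgl_gen l) (can_type hgl_gen_codeK).
End HglGenFinite.

Definition hgl (R : realType) (l : nat) := {ffun hgl_gen l -> R}.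

Section Hgl.
Variables (R : realType) (l : nat).
Local Notation M := 'M[R]_l.+1.
Local Notation gen := (hgl_gen l).
Local Notation hgl := {ffun gen -> R}.

Definition hgl_elt (w : gen) : hgl := [ffun u => (u == w)%:R].

(** The element \sum a_ij e^L_ij + b_ij e^R_ij of gl (+) gl. *)
Definition hgl_of_gl (A B : M) : hgl :=
  [ffun w => match w with genL i j => A i j | genR i j => B i j | _ => 0 end].

Definition gen_bracket (u v : gen) : hgl :=
  match u, v with
  | genL i j, genL k m =>
      (j == k)%:R *: hgl_elt (genL i m) - (i == m)%:R *: hgl_elt (genL k j)
  | genR i j, genR k m =>
      (j == k)%:R *: hgl_elt (genR i m) - (i == m)%:R *: hgl_elt (genR k j)
  | genL i j, genX k m => - ((i == k)%:R *: hgl_elt (genX j m))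
  | genX k m, genL i j => (i == k)%:R *: hgl_elt (genX j m)
  | genL i j, genY k m => (j == k)%:R *: hgl_elt (genY i m)
  | genY k m, genL i j => - ((j == k)%:R *: hgl_elt (genY i m))
  | genR i j, genX k m => (j == m)%:R *: hgl_elt (genX k i)
  | genX k m, genR i j => - ((j == m)%:R *: hgl_elt (genX k i))
  | genR i j, genY k m => - ((i == m)%:R *: hgl_elt (genY k j))
  | genY k m, genR i j => (i == m)%:R *: hgl_elt (genY k j)
  | genX i j, genY k m => ((i == k) && (j == m))%:R *: hgl_elt genC
  | genY k m, genX i j => - (((i == k) && (j == m))%:R *: hgl_elt genC)
  | _, _ => 0
  end.

Definition hgl_bracket (U V : hgl) : hgl :=
  \sum_(u : gen) \sum_(v : gen) (U u * V v) *: gen_bracket u v.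

End Hgl.

Section Schwartz.
Variables (R : realType) (l : nat).
Local Notation M := 'M[R]_l.+1.
Local Notation I2 := ('I_l.+1 * 'I_l.+1)%type.

(** R[i] is not a normed module over R in the library, so derivatives of
    complex-valued functions are taken on the real and imaginary parts. *)
Definition partial (p : I2) (f : M -> R[i]) : M -> R[i] :=
  fun x => 'D_(delta_mx p.1 p.2) (fun y => complex.Re (f y)) x
           +i* 'D_(delta_mx p.1 p.2) (fun y => complex.Im (f y)) x.

(** Multi-indices are sequences of index pairs: [:: p1; ..; pk] stands for
    d/dx_p1 ... d/dx_pk, respectively for the monomial x_p1 ... x_pk. *)
Definition partials (b : seq I2) (f : M -> R[i]) : M -> R[i] :=
  foldr partial f b.

Definition monomial (a : seq I2) (x : M) : R := \prod_(p <- a) x p.1 p.2.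

Definition smooth (f : M -> R[i]) : Prop :=
  forall (b : seq I2) (x : M),
    differentiable (fun y => complex.Re (partials b f y)) x /\
    differentiable (fun y => complex.Im (partials b f y)) x.

Definition weighted_values (a b : seq I2) (f : M -> R[i]) : set R :=
  range (fun x => ComplexField.Normc.normc ((monomial a x)%:C * partials b f x)).

Definition schwartz (f : M -> R[i]) : Prop :=
  smooth f /\ forall a b : seq I2, has_ubound (weighted_values a b f).

Definition seminorm (a b : seq I2) (f : M -> R[i]) : R :=
  sup (weighted_values a b f).

(** A distribution is written as T f = "\int T(x) f(x) dx", linear in f; only
    its values on Schwartz functions matter. *)
Definition tempered (T : (M -> R[i]) -> R[i]) : Prop :=
  (forall (a : R[i]) (f h : M -> R[i]), schwartz f -> schwartz h ->
     T (fun x => a * f x + h x) = a * T f + T h) /\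
  (exists (s : seq (seq I2 * seq I2)) (K : R),
     forall f : M -> R[i], schwartz f ->
       ComplexField.Normc.normc (T f) <= K * \sum_(ab <- s) seminorm ab.1 ab.2 f).

Definition conj_fun (f : M -> R[i]) : M -> R[i] := fun x => (f x)^*.

(** <T, f> = \int conj(T(x)) f(x) dx: conj(T) is the distribution
    f |-> conj (T (conj f)). *)
Definition pairing (T : (M -> R[i]) -> R[i]) (f : M -> R[i]) : R[i] :=
  (T (conj_fun f))^*.

End Schwartz.

(** t ^ z = exp (z ln t), for t > 0 and complex z. *)
Definition cpow (R : realType) (t : R) (z : R[i]) : R[i] :=
  (expR (complex.Re z * ln t))%:C
  * (cos (complex.Im z * ln t) +i* sin (complex.Im z * ln t)).

Section Module.
Variables (R : realType) (l : nat) (kappa c : R).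
Local Notation M := 'M[R]_l.+1.
Local Notation gen := (hgl_gen l).
Local Notation hgl := (hgl R l).

Definition pi_gen (w : gen) (f : M -> R[i]) : M -> R[i] := fun x =>
  match w with
  | genX i j => 'i%C * (x i j)%:C * f x
  | genY i j => - c%:C * partial (i, j) f x
  | genC => 'i%C * c%:C * f x
  | genL i j =>
      - (\sum_(k < l.+1) (x j k)%:C * partial (i, k) f x)
      - (l.+1%:R / 2) * (i == j)%:R * f x
      - 'i%C * kappa%:C * (i == j)%:R * f x
  | genR i j =>
      (\sum_(k < l.+1) (x k i)%:C * partial (k, j) f x)
      + (l.+1%:R / 2) * (i == j)%:R * f x
      + 'i%C * kappa%:C * (i == j)%:R * f x
  end.

Definition pi_hgl (U : hgl) (f : M -> R[i]) : M -> R[i] :=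
  fun x => \sum_(w : gen) (U w)%:C * pi_gen w f x.

(** The one-dimensional representation V_kappa^v (x) V_kappa. *)
Definition pi_kappa (g1 g2 : M) : R[i] :=
  cpow `|\det (invmx g1 *m g2)| ('i%C * kappa%:C).

Definition pi_gl (g1 g2 : M) (f : M -> R[i]) : M -> R[i] := fun x =>
  cpow `|\det (invmx g1 *m g2)| ('i%C * kappa%:C + l.+1%:R / 2)
  * f (invmx g1 *m x *m g2).

(** The contragredient action, defined so that
    <T, pi_hgl U f> = - <pi_hgl_dual U T, f>. *)
Definition pi_hgl_dual (U : hgl) (T : (M -> R[i]) -> R[i]) :
    (M -> R[i]) -> R[i] :=
  fun f => - T (conj_fun (pi_hgl U (conj_fun f))).

Definition spherical_vector : M -> R[i] :=
  fun x => (expR (- (2 * c)^-1 * \tr (x^T *m x)))%:C.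

(** The distribution prod_(i,j) delta(x_ij - delta_ij), i.e. evaluation at the
    identity matrix. *)
Definition whittaker_vector : (M -> R[i]) -> R[i] := fun f => f 1%:M.

End Module.

Section Predicates.
Variables (R : realType) (l : nat).
Local Notation M := 'M[R]_l.+1.
Local Notation hgl := (hgl R l).

Definition is_hgl_module (rho : hgl -> (M -> R[i]) -> (M -> R[i])) : Prop :=
  [/\ forall U f, schwartz f -> schwartz (rho U f),
      forall U (a : R[i]) f h x, schwartz f -> schwartz h ->
        rho U (fun y => a * f y + h y) x = a * rho U f x + rho U h x,
      forall (r : R) U V f x, schwartz f ->
        rho (r *: U + V) f x = r%:C * rho U f x + rho V f x
    & forall U V f x, schwartz f ->
        rho (hgl_bracket U V) f x = rho U (rho V f) x - rho V (rho U f) x].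

Definition is_GLxGL_module (rho : M -> M -> (M -> R[i]) -> (M -> R[i])) : Prop :=
  [/\ forall g1 g2 f, g1 \in unitmx -> g2 \in unitmx ->
        schwartz f -> schwartz (rho g1 g2 f),
      forall g1 g2 (a : R[i]) f h x, g1 \in unitmx -> g2 \in unitmx ->
        schwartz f -> schwartz h ->
        rho g1 g2 (fun y => a * f y + h y) x
        = a * rho g1 g2 f x + rho g1 g2 h x,
      forall f x, schwartz f -> rho 1%:M 1%:M f x = f x
    & forall g1 g2 h1 h2 f x,
        g1 \in unitmx -> g2 \in unitmx -> h1 \in unitmx -> h2 \in unitmx ->
        schwartz f ->
        rho (g1 *m h1) (g2 *m h2) f x = rho g1 g2 (rho h1 h2 f) x].

(** The Lie algebra action [rho] on gl (+) gl is the differential at the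
    identity of the group action [Rho]; t |-> (1 + t A, 1 + t B) is a curve with
    velocity (A, B) at t = 0. *)
Definition integrates (rho : hgl -> (M -> R[i]) -> (M -> R[i]))
    (Rho : M -> M -> (M -> R[i]) -> (M -> R[i])) : Prop :=
  forall (A B : M) (f : M -> R[i]) (x : M), schwartz f ->
    is_derive (0 : R) (1 : R)
      (fun t : R => complex.Re (Rho (1%:M + t *: A) (1%:M + t *: B) f x))
      (complex.Re (rho (hgl_of_gl A B) f x)) /\
    is_derive (0 : R) (1 : R)
      (fun t : R => complex.Im (Rho (1%:M + t *: A) (1%:M + t *: B) f x))
      (complex.Im (rho (hgl_of_gl A B) f x)).

Definition is_spherical (rho : hgl -> (M -> R[i]) -> (M -> R[i]))
    (phi : M -> R[i]) : Prop :=
  [/\ forall i j x, rho (hgl_elt R (genX i j)) phi x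
        = 'i%C * rho (hgl_elt R (genY i j)) phi x,
      forall i j x,
        rho (hgl_elt R (genL i j) - hgl_elt R (genL j i)) phi x = 0
    & forall i j x,
        rho (hgl_elt R (genR i j) - hgl_elt R (genR j i)) phi x = 0].

Definition is_whittaker
    (rho_dual : hgl -> ((M -> R[i]) -> R[i]) -> ((M -> R[i]) -> R[i]))
    (psi : (M -> R[i]) -> R[i]) : Prop :=
  (forall i j f, schwartz f ->
     rho_dual (hgl_elt R (genX i j)) psi f = 'i%C * (i == j)%:R * psi f) /\
  (forall i j f, schwartz f ->
     rho_dual (hgl_elt R (genL i j) + hgl_elt R (genR i j)) psi f = 0).

End Predicates.

Definition hecke_baxter (R : realType) (l : nat) (s : R[i]) (c : R)
    (g : 'M[R]_l.+1) : R[i] :=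
  cpow `|\det g| (s + l%:R / 2) * (expR (- (2 * c)^-1 * \tr (g^T *m g)))%:C.

(* Main.v *)
Require Import Defs.
From mathcomp Require Import all_boot all_order all_algebra.
From mathcomp Require Import all_classical all_reals all_analysis.
From mathcomp Require Import complex.
From mathcomp Require Import ring lra.
Set Implicit Arguments.
Unset Strict Implicit.
Unset Printing Implicit Defensive.

Import Order.TTheory GRing.Theory Num.Theory.
Import numFieldNormedType.Exports.
Local Open Scope ring_scope.
Local Open Scope complex_scope.

(** All the structure rests on explicit operators on functions of a real matrix
    [x]: coordinates act by multiplication, their duals by partial derivatives,
    and the two copies of gl by the linear vector fields generating
    [x |-> g1^-1 x g2], corrected by a scalar.

    The matrix element itself is an evaluation. Pairing with the delta
    distribution at the identity evaluates at [x = 1], where the translated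
    Gaussian is [|det g|^(i kappa + (l + 1)/2) exp (- tr (g^T g) / 2c)]; since
    [s + l/2 = i kappa + (l + 1)/2], this is the Hecke-Baxter function
    ([hecke_baxter_pairing]).

    The remaining claims say that this evaluation takes place in a genuine
    module. Their analytic core is the stability of the Schwartz space under all
    the operators. It comes from one criterion, [poly_span_rschwartz]: a set of
    differentiable functions that stay bounded against all monomials generates Schwartz
    functions under polynomial combinations as soon as its partial derivatives are
    such combinations. Applied to the Schwartz functions, to their linear
    substitutions and to a single Gaussian, it yields stability under coordinates
    and derivatives, stability under the group, and the decay of the spherical
    vector.

    The bracket relations reduce to commuting a linear vector field with a
    coordinate and with a partial derivative ([genL_mulx], [genL_partial] and
    their analogues for [genR]), the only analytic input being the symmetry of
    second derivatives ([derive_comm]).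

    The group action differentiates to the Lie algebra action because the orbit
    of [x] has velocity [x B - A x] ([is_derive_curve]) and the logarithm of
    [det ((1 + t A)^-1 (1 + t B))] has derivative [tr B - tr A] at 0
    ([is_derive_ln_det]). Both follow from the fact that determinants and
    adjugates are polynomial in [t]. *)

(** * Real Schwartz functions on a matrix space *)

Section RealFunctions.
Variables (R : realType) (l : nat).
Local Notation M := 'M[R]_l.+1.
Local Notation I2 := ('I_l.+1 * 'I_l.+1)%type.
Implicit Types (g h : M -> R) (p q : I2) (x v : M).

Definition unit_at p : M := delta_mx p.1 p.2.

Definition rpartial p g : M -> R := fun x => 'D_(unit_at p) g x.

Definition rpartials (b : seq I2) g : M -> R := foldr rpartial g b.

Definition rsmooth g := forall b x, differentiable (rpartials b g) x.

Definition weighted_bounded g :=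
  forall a : seq I2, exists K : R, forall x, `|monomial a x * g x| <= K.

Definition rschwartz g :=
  rsmooth g /\ forall b, weighted_bounded (rpartials b g).

Lemma matrix_sum_unit v : v = \sum_p v p.1 p.2 *: unit_at p.
Proof.
rewrite [LHS]matrix_sum_delta pair_bigA /=.
by apply: eq_bigr.
Qed.

Lemma unit_atE p q : unit_at q p.1 p.2 = (p == q)%:R.
Proof. by rewrite mxE -pair_eqE. Qed.

Lemma derive_coords g x v : differentiable g x ->
  'D_v g x = \sum_p v p.1 p.2 * rpartial p g x.
Proof.
move=> dg; rewrite deriveE // {1}[v]matrix_sum_unit linear_sum.
by apply: eq_bigr => p _; rewrite linearZ /rpartial deriveE.
Qed.

Lemma derive_coord x v i j : 'D_v (fun y : M => y i j) x = v i j.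
Proof.
have dv := @derivable_id R M x v.
have /matrixP/(_ i j) := derive_mx dv.
by rewrite derive_id mxE => ->.
Qed.

Lemma rpartialD p g h x : differentiable g x -> differentiable h x ->
  rpartial p (fun y => g y + h y) x = rpartial p g x + rpartial p h x.
Proof.
by move=> dg dh; apply: deriveD; exact: diff_derivable.
Qed.

Lemma rpartialZ p k g x : differentiable g x ->
  rpartial p (fun y => k * g y) x = k * rpartial p g x.
Proof. by move=> dg; apply: deriveZ; exact: diff_derivable. Qed.

Lemma rpartialX q p g x : differentiable g x ->
  rpartial q (fun y => y p.1 p.2 * g y) x =
  (p == q)%:R * g x + x p.1 p.2 * rpartial q g x.
Proof.
move=> dg; rewrite /rpartial.
have -> : (fun y : M => y p.1 p.2 * g y) = (fun y : M => y p.1 p.2) * g by [].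
rewrite deriveM; [|exact/diff_derivable/differentiable_coord|exact: diff_derivable].
by rewrite derive_coord unit_atE addrC; congr (_ + _); rewrite /GRing.scale /= mulrC.
Qed.

(** The functions obtained from the members of [B] by sums, real multiples and
    multiplication by coordinates: the module spanned by [B] over the ring of
    polynomial functions. *)
Inductive poly_span (B : (M -> R) -> Prop) : (M -> R) -> Prop :=
| poly_span_base g : B g -> poly_span B g
| poly_spanD g h : poly_span B g -> poly_span B h ->
    poly_span B (fun x => g x + h x)
| poly_spanZ k g : poly_span B g -> poly_span B (fun x => k * g x)
| poly_spanX p g : poly_span B g -> poly_span B (fun x => x p.1 p.2 * g x).

Section Span.
Variable B : (M -> R) -> Prop.
Hypothesis Bdiff : forall g x, B g -> differentiable g x.
Hypothesis Bpartial : forall g p, B g -> poly_span B (rpartial p g).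
Hypothesis Bbounded : forall g, B g -> weighted_bounded g.

Lemma poly_span_differentiable g x : poly_span B g -> differentiable g x.
Proof.
elim=> [{}g /Bdiff //|{}g h _ dg _ dh|k {}g _ dg|p {}g _ dg].
- exact: differentiableD.
- exact: differentiableZ.
- by apply: differentiableM => //; exact: differentiable_coord.
Qed.

Lemma poly_span_partial g p : poly_span B g -> poly_span B (rpartial p g).
Proof.
elim=> [{}g /Bpartial //|{}g h Sg IHg Sh IHh|k {}g Sg IHg|q {}g Sg IHg].
- suff -> : rpartial p (fun x => g x + h x) = fun x => rpartial p g x + rpartial p h x.
    exact: poly_spanD.
  by apply/funext => x; apply: rpartialD; exact: poly_span_differentiable.
- suff -> : rpartial p (fun x => k * g x) = fun x => k * rpartial p g x.
    exact: poly_spanZ.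
  by apply/funext => x; apply: rpartialZ; exact: poly_span_differentiable.
- suff -> : rpartial p (fun x => x q.1 q.2 * g x) =
            fun x => (q == p)%:R * g x + x q.1 q.2 * rpartial p g x.
    by apply: poly_spanD; [exact: poly_spanZ|exact: poly_spanX].
  by apply/funext => x; apply: rpartialX; exact: poly_span_differentiable.
Qed.

Lemma poly_span_bounded g : poly_span B g -> weighted_bounded g.
Proof.
elim=> [{}g /Bbounded //|{}g h _ IHg _ IHh|k {}g _ IHg|q {}g _ IHg] a.
- have [K1 H1] := IHg a; have [K2 H2] := IHh a.
  exists (K1 + K2) => x; rewrite mulrDr.
  exact: (le_trans (ler_normD _ _) (lerD (H1 x) (H2 x))).
- have [K H] := IHg a; exists (`|k| * K) => x.
  by rewrite mulrCA normrM ler_wpM2l.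
- have [K H] := IHg (q :: a); exists K => x.
  by have := H x; rewrite /monomial big_cons mulrCA mulrA.
Qed.

(** The tool behind every closure property of the Schwartz space below. By the
    Leibniz rule the span of [B] is stable under partial derivatives as soon as
    these send [B] into the span, and multiplying by one more coordinate only
    lengthens the monomial [a]. Hence every iterated derivative of a member of the
    span is again differentiable and decays, and it is enough to bound the
    members of [B] themselves, without any derivative. *)
Lemma poly_span_rschwartz g : poly_span B g -> rschwartz g.
Proof.
move=> Sg; have Sb b : poly_span B (rpartials b g).
  by elim: b => //= p b IH; exact: poly_span_partial.
by split=> b; [move=> x; exact: poly_span_differentiable|exact: poly_span_bounded].
Qed.

End Span.

Lemma rschwartz_diff g x : rschwartz g -> differentiable g x.
Proof. by case=> /(_ [::] x). Qed.

Lemma rschwartz_partial p g : rschwartz g -> rschwartz (rpartial p g).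
Proof.
have E b : rpartials b (rpartial p g) = rpartials (rcons b p) g.
  by rewrite /rpartials foldr_rcons.
by case=> sg bg; split=> b; rewrite ?/rsmooth E.
Qed.

Lemma rschwartz_poly_span g : poly_span rschwartz g -> rschwartz g.
Proof.
apply: poly_span_rschwartz => [{}g x|{}g p|{}g].
- exact: rschwartz_diff.
- by move=> sg; exact/poly_span_base/rschwartz_partial.
- by case=> _ /(_ [::]).
Qed.

Lemma rschwartzD g h : rschwartz g -> rschwartz h ->
  rschwartz (fun x => g x + h x).
Proof. by move=> *; apply/rschwartz_poly_span/poly_spanD; exact: poly_span_base. Qed.

Lemma rschwartzZ k g : rschwartz g -> rschwartz (fun x => k * g x).
Proof. by move=> *; apply/rschwartz_poly_span/poly_spanZ; exact: poly_span_base. Qed.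

Lemma rschwartzX p g : rschwartz g -> rschwartz (fun x => x p.1 p.2 * g x).
Proof. by move=> *; apply/rschwartz_poly_span/poly_spanX; exact: poly_span_base. Qed.

Lemma rschwartz0 : rschwartz (fun=> 0).
Proof.
apply: (@poly_span_rschwartz (eq (fun=> 0))); last exact: poly_span_base.
- by move=> g x <-; exact: differentiable_cst.
- move=> g p g0; have -> : rpartial p g = fun x => 0 * g x.
    by apply/funext => x; rewrite -g0 mul0r; exact: derive_cst.
  by apply/poly_spanZ/poly_span_base.
- by move=> g <- a; exists 0 => x; rewrite mulr0 normr0.
Qed.

Lemma rschwartz_sum (I : Type) (r : seq I) (F : I -> M -> R) :
  (forall i, rschwartz (F i)) -> rschwartz (fun x => \sum_(i <- r) F i x).
Proof.
move=> sF; elim: r => [|i r IH].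
  by under eq_fun do rewrite big_nil; exact: rschwartz0.
by under eq_fun do rewrite big_cons; apply: rschwartzD.
Qed.

Section Translation.
Implicit Types P Q : M.

Lemma translate_sum_unit P Q v :
  P *m v *m Q = \sum_p v p.1 p.2 *: (P *m unit_at p *m Q).
Proof.
rewrite {1}[v]matrix_sum_unit mulmx_sumr mulmx_suml.
by apply: eq_bigr => p _; rewrite -scalemxAr -scalemxAl.
Qed.

Lemma translate_differentiable P Q x :
  differentiable (fun y : M => P *m y *m Q) x.
Proof.
have -> : (fun y : M => P *m y *m Q) =
    \sum_p (fun y : M => y p.1 p.2 *: (P *m unit_at p *m Q)).
  by apply/funext => y; rewrite translate_sum_unit fct_sumE.
elim/big_ind: _ => [|f g|p _]; first exact: differentiable_cst.
- exact: differentiableD.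
- by apply: differentiableZl; exact: differentiable_coord.
Qed.

Lemma derive_translate P Q g x v :
  'D_v (fun y => g (P *m y *m Q)) x = 'D_(P *m v *m Q) g (P *m x *m Q).
Proof.
rewrite /derive.
by under [in LHS]eq_fun do rewrite /= mulmxDr mulmxDl -scalemxAr -scalemxAl.
Qed.

(** The derivatives of [g (P x Q)] are combinations of functions [h (P x Q)] with
    [h] Schwartz, so that only the decay has to be checked. There each
    coordinate of [x] is a linear form in [y = P x Q], because [P] and [Q] are
    invertible, and is absorbed into [h] as a factor depending on [y]. *)
Lemma rschwartz_translate P Q g : P \in unitmx -> Q \in unitmx ->
  rschwartz g -> rschwartz (fun x => g (P *m x *m Q)).
Proof.
move=> uP uQ sg; pose B (f : M -> R) :=
  exists2 h, rschwartz h & f = (fun x => h (P *m x *m Q)).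
apply: (@poly_span_rschwartz B); last by apply: poly_span_base; exists g.
- move=> _ x [h sh ->]; apply: differentiable_comp.
    exact: translate_differentiable.
  exact: rschwartz_diff.
- move=> _ p [h sh ->]; apply: poly_span_base.
  exists (fun y => \sum_q (P *m unit_at p *m Q) q.1 q.2 * rpartial q h y).
    by apply: rschwartz_sum => q; exact/rschwartzZ/rschwartz_partial.
  apply/funext => x; rewrite /rpartial derive_translate derive_coords //.
  exact: rschwartz_diff.
- move=> _ [h sh ->] a; elim: a h sh => [|p a IH] h sh.
    have [K H] := sh.2 [::] [::]; exists K => x.
    by have := H (P *m x *m Q); rewrite /monomial !big_nil.
  have [|K HK] := IH (fun y => (invmx P *m y *m invmx Q) p.1 p.2 * h y).
    have -> : (fun y => (invmx P *m y *m invmx Q) p.1 p.2 * h y) =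
        fun y => \sum_q (invmx P *m unit_at q *m invmx Q) p.1 p.2 * (y q.1 q.2 * h y).
      apply/funext => y; rewrite translate_sum_unit summxE.
      rewrite mulr_suml; apply: eq_bigr => q _.
      by rewrite mxE mulrCA mulrA.
    by apply: rschwartz_sum => q; exact/rschwartzZ/rschwartzX.
  exists K => x; have := HK x.
  by rewrite /= -!mulmxA mulmxV // mulmx1 mulKmx // /monomial big_cons mulrCA mulrA.
Qed.
End Translation.

(** * Symmetry of second derivatives *)

Lemma is_derive_line g x v t : differentiable g (x + t *: v) ->
  is_derive t 1 (fun s : R => g (x + s *: v)) ('D_v g (x + t *: v)).
Proof.
move=> dg; have dv := diff_derivable (v := v) dg.
have E : (fun h : R => h^-1 *: (((fun s => g (x + s *: v)) \o shift t) (h *: 1) -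
            g (x + t *: v))) =
         (fun h : R => h^-1 *: ((g \o shift (x + t *: v)) (h *: v) - g (x + t *: v))).
  apply/funext => h /=; congr (_ *: (g _ - _)).
  by rewrite scalerDl [h *: 1]mulr1 addrCA.
by split; rewrite ?/derivable ?/derive E.
Qed.

Lemma mean_value_line g x v (t : R) : 0 < t -> (forall y, differentiable g y) ->
  exists2 s, 0 < s < t & g (x + t *: v) - g x = t * 'D_v g (x + s *: v).
Proof.
move=> t0 dg; have D s := is_derive_line (t := s) (dg (x + s *: v)).
have [|s] := MVT t0 (f := fun s => g (x + s *: v)) (fun s _ => D s).
- by apply: continuous_subspaceT => s; apply/differentiable_continuous/derivable1_diffP.
- by rewrite in_itv /= scale0r addr0 subr0 mulrC => st ->; exists s.
Qed.

(** Two applications of the mean value theorem, in the direction [u] to the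
    increment [g (y + t v) - g y] and then in the direction [v] to the
    derivative ['D_u g]. *)
Lemma second_difference g x u v t : 0 < t -> (forall y, differentiable g y) ->
  (forall y, differentiable ('D_u g) y) ->
  exists s r, [/\ 0 < s < t, 0 < r < t &
    g (x + t *: u + t *: v) - g (x + t *: u) - g (x + t *: v) + g x =
    t ^+ 2 * 'D_v ('D_u g) (x + s *: u + r *: v)].
Proof.
move=> t0 dg ddg; pose h y := g (y + t *: v) - g y.
have dsh y : differentiable (fun z => g (z + t *: v)) y.
  apply: differentiable_comp; last exact: dg.
  by apply: differentiableD; [exact: ex_diff|exact: differentiable_cst].
have dh y : differentiable h y by exact: differentiableB.
have [s st Es] := mean_value_line x u t0 dh.
have [r rt Er] := mean_value_line (x + s *: u) v t0 ddg.
exists s, r; split=> //.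
have -> : 'D_v ('D_u g) (x + s *: u + r *: v) = t^-1 * ('D_u h (x + s *: u)).
  have -> : 'D_u h (x + s *: u) =
    'D_u g (x + s *: u + t *: v) - 'D_u g (x + s *: u).
    rewrite /h deriveB; [|exact/diff_derivable|exact/diff_derivable].
    congr (_ - _); rewrite /derive.
    by under [in LHS]eq_fun do rewrite /= -[_ *: u + _ + _]addrA.
  by rewrite Er mulKf // gt_eqF.
by rewrite expr2 -mulrA mulVKf ?gt_eqF // -Es /h; ring.
Qed.

(** The second difference is symmetric in [u] and [v], so [second_difference]
    makes the two mixed derivatives agree at points arbitrarily close to [x],
    and continuity carries the equality to [x]. *)
Lemma derive_comm g u v x : (forall y, differentiable g y) ->
  (forall y, differentiable ('D_u g) y) -> (forall y, differentiable ('D_v g) y) ->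
  {for x, continuous ('D_v ('D_u g))} -> {for x, continuous ('D_u ('D_v g))} ->
  'D_v ('D_u g) x = 'D_u ('D_v g) x.
Proof.
move=> dg dgu dgv cvu cuv; apply/eqP; rewrite -subr_eq0 -normr_le0.
apply/ler_addgt0Pr => e e0; rewrite add0r.
have e2 : 0 < e / 2 by rewrite divr_gt0.
have [d /= d0 Hd] : exists2 d : R, 0 < d & forall y, `|x - y| < d ->
    `|'D_v ('D_u g) x - 'D_v ('D_u g) y| < e / 2 /\
    `|'D_u ('D_v g) x - 'D_u ('D_v g) y| < e / 2.
  have /cvgrPdist_lt/(_ _ e2) nvu := cvu.
  have /cvgrPdist_lt/(_ _ e2) nuv := cuv.
  have [d /= d0 Hd] := (nbhs_ballP _ _).1 (filterI nvu nuv).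
  by exists d => // y xy; apply: Hd; rewrite -ball_normE.
have N0 : 0 < `|u| + `|v| + 1 by rewrite ltr_wpDl // addr_ge0.
(* the + 1 keeps the quotient defined when u = v = 0 and makes the points
   x + s u + r v with s, r < t lie strictly inside the ball of radius d *)
pose t := d / (`|u| + `|v| + 1).
have t0 : 0 < t by rewrite divr_gt0.
have close w z s r : 0 < s < t -> 0 < r < t -> `|w| + `|z| = `|u| + `|v| ->
    `|x - (x + s *: w + r *: z)| < d.
  move=> /andP[s0 st] /andP[r0 rt] wz.
  rewrite -[x + _ + _]addrA opprD addNKr normrN.
  apply: le_lt_trans (ler_normD _ _) _; rewrite !normrZ !gtr0_norm //.
  have dE : t * (`|u| + `|v| + 1) = d by rewrite /t divfK // gt_eqF.
  rewrite -dE -wz 2!mulrDr mulr1 -addrA.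
  apply: ler_ltD; first by apply: ler_pM => //; exact: ltW.
  rewrite ltr_pwDr //.
  by apply: ler_pM => //; exact: ltW.
have [s [r [st rt E1]]] := second_difference x v t0 dg dgu.
have [s' [r' [st' rt' E2]]] := second_difference x u t0 dg dgv.
have E : 'D_v ('D_u g) (x + s *: u + r *: v) = 'D_u ('D_v g) (x + s' *: v + r' *: u).
  apply: (mulfI (_ : t ^+ 2 != 0)); first by rewrite expf_neq0 // gt_eqF.
  by rewrite -E1 -E2 [x + t *: v + _]addrAC; ring.
have [H1 _] := Hd _ (close u v s r st rt erefl).
have [_ H2] := Hd _ (close v u s' r' st' rt' (addrC _ _)).
rewrite -E in H2; apply: ltW; rewrite [e]splitr.
rewrite -(subrKA ('D_v ('D_u g) (x + s *: u + r *: v))).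
by apply: le_lt_trans (ler_normD _ _) (ltrD H1 _); rewrite distrC.
Qed.

Lemma rpartialC p q g : rsmooth g ->
  rpartial p (rpartial q g) = rpartial q (rpartial p g).
Proof.
move=> sg; apply/funext => x; apply: derive_comm => [y|y|y||].
- exact: (sg [::]).
- exact: (sg [:: q]).
- exact: (sg [:: p]).
- exact/differentiable_continuous/(sg [:: p; q]).
- exact/differentiable_continuous/(sg [:: q; p]).
Qed.
End RealFunctions.

(** * Gaussians *)

Section Gaussian.
Variables (R : realType) (l : nat).
Local Notation M := 'M[R]_l.+1.
Local Notation I2 := ('I_l.+1 * 'I_l.+1)%type.
Implicit Types (g h : M -> R) (p q : I2) (x v : M).

Definition gaussian (k : R) (x : M) : R := expR (- k * \tr (x^T *m x)).

Lemma trace_gram x : \tr (x^T *m x) = \sum_p x p.1 p.2 ^+ 2.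
Proof.
rewrite /mxtrace (eq_bigr (fun j => \sum_i x i j ^+ 2)) => [|j _].
  by rewrite exchange_big pair_bigA.
by rewrite mxE; apply: eq_bigr => i _; rewrite mxE expr2.
Qed.

Lemma trace_gram_diff x v :
  differentiable (fun y : M => \tr (y^T *m y)) x /\
  'D_v (fun y : M => \tr (y^T *m y)) x = \sum_p 2 * x p.1 p.2 * v p.1 p.2.
Proof.
under [fun y => _]eq_fun do rewrite trace_gram.
elim: (index_enum _) => [|p r [dN DN]].
  under [fun y => _]eq_fun do rewrite big_nil.
  by rewrite big_nil; split; [exact: differentiable_cst|exact: derive_cst].
have -> : (fun y : M => \sum_(q <- p :: r) y q.1 q.2 ^+ 2) =
    (fun y : M => y p.1 p.2) * (fun y : M => y p.1 p.2)
    + (fun y : M => \sum_(q <- r) y q.1 q.2 ^+ 2).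
  by apply/funext => y; rewrite big_cons expr2.
have dp : differentiable (fun y : M => y p.1 p.2) x by exact: differentiable_coord.
split; first by apply: differentiableD => //; exact: differentiableM.
rewrite deriveD; [|by apply/diff_derivable/differentiableM|exact/diff_derivable].
rewrite DN deriveM; [|exact/diff_derivable|exact/diff_derivable].
by rewrite derive_coord big_cons -mulrA mulrDl mul1r.
Qed.

Lemma derive_comp_real (phi : R -> R) g x v d :
  is_derive (g x) 1 phi d -> differentiable g x ->
  'D_v (phi \o g) x = d * 'D_v g x.
Proof.
move=> [dphi <-] dg; have dphi' := (derivable1_diffP _ _).1 dphi.
rewrite deriveE; last exact: differentiable_comp dg dphi'.
rewrite (diff_comp dg dphi') /= (deriv1E dphi) derive1E -(deriveE _ dg).
by rewrite [LHS]mulrC.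
Qed.

Lemma gaussian_diff k x : differentiable (gaussian k) x.
Proof.
apply: differentiable_comp; last exact/derivable1_diffP.
by apply: differentiableZ; exact: (trace_gram_diff x 0).1.
Qed.

Lemma rpartial_gaussian k p x :
  rpartial p (gaussian k) x = (- 2 * k) * (x p.1 p.2 * gaussian k x).
Proof.
have [dN DN] := trace_gram_diff x (unit_at _ p).
rewrite /rpartial /gaussian.
rewrite (@derive_comp_real expR (fun y => - k * \tr (y^T *m y)) _ _
  (expR (- k * \tr (x^T *m x)))); last 1 first.
- exact: differentiableZ.
rewrite deriveZ ?DN; last exact: diff_derivable.
rewrite (bigD1 p) //= big1 => [|q qp].
  by rewrite unit_atE eqxx; rewrite /GRing.scale /=; ring.
by rewrite unit_atE (negbTE qp) mulr0.
Qed.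

(** In absolute value each coordinate is at most [1 + N], where
    [N = tr (x^T x)], and [1 + N] is dominated by every exponential
    [exp (k N / 2)]. Spending half of the exponent on one factor and half on the
    others gives the induction. *)
Lemma monomial_le_exp (a : seq I2) (k : R) : 0 < k ->
  exists K, 0 <= K /\ forall x : M, `|monomial a x| <= K * expR (k * \tr (x^T *m x)).
Proof.
elim: a k => [|p a IH] k k0.
  exists 1; split=> // x; rewrite /monomial big_nil normr1 mul1r.
  rewrite -expR0 ler_expR mulr_ge0 ?(ltW k0) // trace_gram.
  by apply: sumr_ge0 => p _; exact: sqr_ge0.
have k2 : 0 < k / 2 by rewrite divr_gt0.
have [K [K0 HK]] := IH _ k2; pose C := 1 + 2 / k.
have C0 : 0 <= C by rewrite addr_ge0 // divr_ge0 // ltW.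
exists (C * K); split=> [|x]; first exact: mulr_ge0.
rewrite /monomial big_cons normrM -/(monomial a x).
have -> : expR (k * \tr (x^T *m x)) =
    expR (k / 2 * \tr (x^T *m x)) * expR (k / 2 * \tr (x^T *m x)).
  by rewrite -expRD -mulrDl -splitr.
rewrite mulrACA.
apply: ler_pM => //.
apply: (@le_trans _ _ (1 + \tr (x^T *m x))).
  rewrite trace_gram (bigD1 p) //=.
  set S := \sum_(_ | _) _; have S0 : 0 <= S.
    by apply: sumr_ge0 => q _; exact: sqr_ge0.
  rewrite -(real_normK (num_real (x p.1 p.2))).
  by have := normr_ge0 (x p.1 p.2); nra.
set N := \tr _; have N0 : 0 <= N.
  by rewrite /N trace_gram; apply: sumr_ge0 => q _; exact: sqr_ge0.
have E1 := expR_ge1Dx (k / 2 * N).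
apply: le_trans (ler_wpM2l C0 E1).
have kk : 2 / k * (k / 2 * N) = N by field; exact: lt0r_neq0.
have kN : 0 <= k / 2 * N by rewrite mulr_ge0 // ltW.
have k1 : 0 <= 2 / k by rewrite divr_ge0 // ltW.
by rewrite /C mulrDr mulr1 [X in _ <= _ + X]mulrDl kk; nra.
Qed.

Lemma rschwartz_gaussian k : 0 < k -> rschwartz (gaussian k).
Proof.
move=> k0; apply: (@poly_span_rschwartz _ _ (eq (gaussian k))); last exact: poly_span_base.
- by move=> _ x <-; exact: gaussian_diff.
- move=> _ p <-; have -> : rpartial p (gaussian k) =
      fun x => (- 2 * k) * (x p.1 p.2 * gaussian k x).
    by apply/funext => x; exact: rpartial_gaussian.
  by apply/poly_spanZ/poly_spanX/poly_span_base.
- move=> _ <- a; have [K [_ HK]] := monomial_le_exp a k0.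
  exists K => x; rewrite normrM [`|gaussian k x|]ger0_norm ?expR_ge0 //.
  by rewrite /gaussian mulNr expRN ler_pdivrMr ?expR_gt0.
Qed.
End Gaussian.

(** * Complex-valued Schwartz functions *)

Section ComplexFunctions.
Variables (R : realType) (l : nat).
Local Notation M := 'M[R]_l.+1.
Local Notation I2 := ('I_l.+1 * 'I_l.+1)%type.
Local Notation Re := complex.Re.
Local Notation Im := complex.Im.
Local Notation normc := ComplexField.Normc.normc.
Implicit Types (f h : M -> R[i]) (p q : I2) (x v : M) (a : R[i]).

Lemma complex_eq (z w : R[i]) : Re z = Re w -> Im z = Im w -> z = w.
Proof. by case: z w => [? ?] [? ?] /= -> ->. Qed.

Lemma ReM (z w : R[i]) : Re (z * w) = Re z * Re w - Im z * Im w.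
Proof. by case: z w => [? ?] [? ?]. Qed.

Lemma ImM (z w : R[i]) : Im (z * w) = Re z * Im w + Im z * Re w.
Proof. by case: z w => [? ?] [? ?]. Qed.

Lemma ReD (z w : R[i]) : Re (z + w) = Re z + Re w.
Proof. by case: z w => [? ?] [? ?]. Qed.

Lemma ImD (z w : R[i]) : Im (z + w) = Im z + Im w.
Proof. by case: z w => [? ?] [? ?]. Qed.

Lemma normc_ge_Re (z : R[i]) : `|Re z| <= normc z.
Proof.
by case: z => u w /=; rewrite -sqrtr_sqr ler_wsqrtr // lerDl sqr_ge0.
Qed.

Lemma normc_ge_Im (z : R[i]) : `|Im z| <= normc z.
Proof.
by case: z => u w /=; rewrite -sqrtr_sqr ler_wsqrtr // lerDr sqr_ge0.
Qed.

Lemma normc_le_ReIm (z : R[i]) : normc z <= `|Re z| + `|Im z|.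
Proof.
case: z => u w /=; rewrite -[leRHS]ger0_norm ?addr_ge0 // -sqrtr_sqr.
rewrite ler_wsqrtr // sqrrD !real_normK ?num_real //.
by rewrite addrAC lerDl mulrn_wge0 // mulr_ge0.
Qed.

Lemma Re_partials b f :
  (fun y => Re (partials b f y)) = rpartials b (fun y => Re (f y)).
Proof. by elim: b => //= p b <-. Qed.

Lemma Im_partials b f :
  (fun y => Im (partials b f y)) = rpartials b (fun y => Im (f y)).
Proof. by elim: b => //= p b <-. Qed.

(** Reduces complex Schwartz functions to pairs of real ones: the derivatives
    are taken componentwise, and the modulus is equivalent to the sum of the
    absolute values of the components. *)
Lemma schwartzP f : schwartz f <->
  rschwartz (fun y => Re (f y)) /\ rschwartz (fun y => Im (f y)).
Proof.
split=> [[sf bf]|[[sr br] [si bi]]].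
- split; split=> b; rewrite /rsmooth -?Re_partials -?Im_partials.
  + by move=> x; exact: (sf b x).1.
  + move=> a; have [K HK] := bf a b; exists K => x.
    have := HK _ (ex_intro2 _ _ x I erefl).
    by apply: le_trans; rewrite -[X in `|X|](_ : Re ((monomial a x)%:C * partials b f x) = _)
      ?normc_ge_Re // ReM /= mul0r subr0.
  + by move=> x; exact: (sf b x).2.
  + move=> a; have [K HK] := bf a b; exists K => x.
    have := HK _ (ex_intro2 _ _ x I erefl).
    by apply: le_trans; rewrite -[X in `|X|](_ : Im ((monomial a x)%:C * partials b f x) = _)
      ?normc_ge_Im // ImM /= mul0r addr0.
- split=> [b x|a b]; first by rewrite Re_partials Im_partials.
  have [K1 H1] := br b a; have [K2 H2] := bi b a.
  exists (K1 + K2) => _ [x _ <-]; apply: le_trans (normc_le_ReIm _) _.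
  rewrite ReM ImM /= !mul0r subr0 addr0.
  have := H1 x; have := H2 x; rewrite -Re_partials -Im_partials.
  by move=> ? ?; exact: lerD.
Qed.

Lemma schwartz_lin a f h : schwartz f -> schwartz h ->
  schwartz (fun x => a * f x + h x).
Proof.
move=> /schwartzP[fr fi] /schwartzP[hr hi]; apply/schwartzP; split.
- under eq_fun do rewrite ReD ReM -mulNr.
  by do 2?[apply: rschwartzD] => //; exact: rschwartzZ.
- under eq_fun do rewrite ImD ImM.
  by do 2?[apply: rschwartzD] => //; exact: rschwartzZ.
Qed.

Lemma schwartz0 : schwartz (fun _ : M => 0 : R[i]).
Proof. by apply/schwartzP; split; exact: rschwartz0. Qed.

Lemma schwartzZ a f : schwartz f -> schwartz (fun x => a * f x).
Proof.
by move=> sf; have := schwartz_lin a sf schwartz0; under eq_fun do rewrite addr0.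
Qed.

Lemma schwartzD f h : schwartz f -> schwartz h -> schwartz (fun x => f x + h x).
Proof.
by move=> sf sh; have := schwartz_lin 1 sf sh; under eq_fun do rewrite mul1r.
Qed.

Lemma schwartz_sum (I : Type) (r : seq I) (F : I -> M -> R[i]) :
  (forall i, schwartz (F i)) -> schwartz (fun x => \sum_(i <- r) F i x).
Proof.
move=> sF; elim: r => [|i r IH].
  by under eq_fun do rewrite big_nil; exact: schwartz0.
by under eq_fun do rewrite big_cons; apply: schwartzD.
Qed.

Lemma schwartz_partial p f : schwartz f -> schwartz (partial p f).
Proof.
by move=> /schwartzP[fr fi]; apply/schwartzP; split; exact: rschwartz_partial.
Qed.

Definition mulx p f : M -> R[i] := fun x => (x p.1 p.2)%:C * f x.

Lemma schwartz_mulx p f : schwartz f -> schwartz (mulx p f).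
Proof.
move=> /schwartzP[fr fi]; apply/schwartzP; split.
- by under eq_fun do rewrite ReM mul0r subr0; exact: rschwartzX.
- by under eq_fun do rewrite ImM mul0r addr0; exact: rschwartzX.
Qed.

Lemma schwartz_translate (P Q : M) f : P \in unitmx -> Q \in unitmx ->
  schwartz f -> schwartz (fun x => f (P *m x *m Q)).
Proof.
move=> uP uQ /schwartzP[fr fi].
by apply/schwartzP; split; [exact: (rschwartz_translate uP uQ fr)|
  exact: (rschwartz_translate uP uQ fi)].
Qed.

Lemma partial_lin p a f h x : schwartz f -> schwartz h ->
  partial p (fun y => a * f y + h y) x = a * partial p f x + partial p h x.
Proof.
move=> /schwartzP[fr fi] /schwartzP[hr hi].
have dfr := rschwartz_diff x fr; have dfi := rschwartz_diff x fi.
have dhr := rschwartz_diff x hr; have dhi := rschwartz_diff x hi.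
have rE g : 'D_(delta_mx p.1 p.2) g x = rpartial p g x by [].
apply: complex_eq; rewrite ?(ReD, ImD, ReM, ImM) /partial /= !rE.
- have -> : (fun y => Re (a * f y + h y)) =
      (fun y => (Re a * Re (f y) + - Im a * Im (f y)) + Re (h y)).
    by apply/funext => y; rewrite ReD ReM mulNr.
  have d1 := differentiableZ (Re a) dfr; have d2 := differentiableZ (- Im a) dfi.
  have d12 := differentiableD d1 d2.
  by rewrite (rpartialD _ d12 dhr) (rpartialD _ d1 d2) !rpartialZ // mulNr.
- have -> : (fun y => Im (a * f y + h y)) =
      (fun y => (Re a * Im (f y) + Im a * Re (f y)) + Im (h y)).
    by apply/funext => y; rewrite ImD ImM.
  have d1 := differentiableZ (Re a) dfi; have d2 := differentiableZ (Im a) dfr.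
  have d12 := differentiableD d1 d2.
  by rewrite (rpartialD _ d12 dhi) (rpartialD _ d1 d2) !rpartialZ.
Qed.

Lemma partial0 p x : partial p (fun=> 0) x = 0.
Proof. by rewrite /partial !derive_cst. Qed.

Lemma partialZ p a f x : schwartz f ->
  partial p (fun y => a * f y) x = a * partial p f x.
Proof.
move=> sf; have := partial_lin p a x sf schwartz0.
by rewrite partial0 addr0; under [in X in X -> _]eq_fun do rewrite addr0.
Qed.

Lemma partialD p f h x : schwartz f -> schwartz h ->
  partial p (fun y => f y + h y) x = partial p f x + partial p h x.
Proof.
move=> sf sh; have := partial_lin p 1 x sf sh.
by rewrite mul1r; under [in X in X -> _]eq_fun do rewrite mul1r.
Qed.

Lemma partial_sum p (I : Type) (r : seq I) (F : I -> M -> R[i]) x :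
  (forall i, schwartz (F i)) ->
  partial p (fun y => \sum_(i <- r) F i y) x = \sum_(i <- r) partial p (F i) x.
Proof.
move=> sF; elim: r => [|i r IH].
  by under eq_fun do rewrite big_nil; rewrite partial0 big_nil.
under eq_fun do rewrite big_cons.
by rewrite partialD ?IH ?big_cons //; exact: schwartz_sum.
Qed.

Lemma partial_mulx p q f x : schwartz f ->
  partial p (mulx q f) x = (p == q)%:R * f x + mulx q (partial p f) x.
Proof.
move=> /schwartzP[fr fi].
have dfr := rschwartz_diff x fr; have dfi := rschwartz_diff x fi.
have nat_Re (b : bool) : Re b%:R = b%:R :> R by case: b.
have nat_Im (b : bool) : Im b%:R = 0 :> R by case: b.
have rE g : 'D_(delta_mx p.1 p.2) g x = rpartial p g x by [].
apply: complex_eq.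
- rewrite ReD !ReM nat_Re nat_Im !mul0r !subr0 /partial /= !rE.
  have -> : (fun y => Re (mulx q f y)) = (fun y => y q.1 q.2 * Re (f y)).
    by apply/funext => y; rewrite ReM /= mul0r subr0.
  by rewrite rpartialX // eq_sym.
- rewrite ImD !ImM nat_Re nat_Im !mul0r !addr0 /partial /= !rE.
  have -> : (fun y => Im (mulx q f y)) = (fun y => y q.1 q.2 * Im (f y)).
    by apply/funext => y; rewrite ImM /= mul0r addr0.
  by rewrite rpartialX // eq_sym.
Qed.

Lemma partialC p q f x : schwartz f ->
  partial p (partial q f) x = partial q (partial p f) x.
Proof.
move=> /schwartzP[[fr _] [fi _]].
apply: complex_eq.
- exact: (congr1 (fun g => g x) (rpartialC p q fr)).
- exact: (congr1 (fun g => g x) (rpartialC p q fi)).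
Qed.

End ComplexFunctions.

(** * Commutators of the operators representing the generators *)

Section LieAction.
Variables (R : realType) (l : nat) (kappa c : R).
Local Notation M := 'M[R]_l.+1.
Local Notation I2 := ('I_l.+1 * 'I_l.+1)%type.
Local Notation pi := (@pi_gen R l kappa c).
Implicit Types (f h : M -> R[i]) (p q : I2) (x v : M) (a : R[i]) (w u : hgl_gen l).

(** The scalar by which the operators of [genR i i], and up to sign those of
    [genL i i], differ from vector fields; also the exponent of the determinant
    in the group action. *)
Definition weight : R[i] := l.+1%:R / 2 + 'i%C * kappa%:C.

Lemma genLE i j f : pi (genL i j) f = fun x =>
  -1 * (\sum_k mulx (j, k) (partial (i, k) f) x) + - (weight * (i == j)%:R) * f x.
Proof. by apply/funext => x; rewrite /= /mulx /weight /=; ring. Qed.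

Lemma genRE i j f : pi (genR i j) f = fun x =>
  1 * (\sum_k mulx (k, i) (partial (k, j) f) x) + weight * (i == j)%:R * f x.
Proof. by apply/funext => x; rewrite /= /mulx /weight /=; ring. Qed.

Lemma genXE i j f : pi (genX i j) f = fun x => 'i%C * mulx (i, j) f x.
Proof. by apply/funext => x; rewrite /= /mulx /= mulrA. Qed.

Lemma genYE i j f : pi (genY i j) f = fun x => - c%:C * partial (i, j) f x.
Proof. by []. Qed.

Lemma genCE f : pi genC f = fun x => 'i%C * c%:C * f x.
Proof. by []. Qed.

Local Arguments pi_gen : simpl never.

Lemma schwartz_pi_gen w f : schwartz f -> schwartz (pi w f).
Proof.
move=> sf; case: w => [i j|i j|i j|i j|].
- rewrite genLE; apply: schwartz_lin; last exact: schwartzZ.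
  by apply: schwartz_sum => k; exact/schwartz_mulx/schwartz_partial.
- rewrite genRE; apply: schwartz_lin; last exact: schwartzZ.
  by apply: schwartz_sum => k; exact/schwartz_mulx/schwartz_partial.
- by rewrite genXE; exact/schwartzZ/schwartz_mulx.
- by rewrite genYE; exact/schwartzZ/schwartz_partial.
- exact: schwartzZ.
Qed.

Lemma pi_gen_lin w a f h x : schwartz f -> schwartz h ->
  pi w (fun y => a * f y + h y) x = a * pi w f x + pi w h x.
Proof.
move=> sf sh.
have sumE (F q : 'I_l.+1 -> I2) :
    \sum_k mulx (F k) (partial (q k) (fun y => a * f y + h y)) x =
    a * (\sum_k mulx (F k) (partial (q k) f) x)
    + \sum_k mulx (F k) (partial (q k) h) x.
  rewrite mulr_sumr -big_split; apply: eq_bigr => k _ /=.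
  by rewrite /mulx partial_lin // mulrDr mulrCA.
case: w => [i j|i j|i j|i j|].
- by rewrite !genLE sumE; ring.
- by rewrite !genRE sumE; ring.
- by rewrite !genXE /mulx; ring.
- by rewrite !genYE partial_lin //; ring.
- by rewrite !genCE; ring.
Qed.

Lemma pi_gen0 w x : pi w (fun=> 0) x = 0.
Proof.
have := pi_gen_lin w (-1) x (schwartz0 R l) (schwartz0 R l).
have -> : (fun=> -1 * 0 + 0) = (fun=> 0) :> (M -> R[i]).
  by apply/funext => y; rewrite mulr0 addr0.
by move=> ->; rewrite mulN1r addNr.
Qed.

Lemma pi_genZ w a f x : schwartz f -> pi w (fun y => a * f y) x = a * pi w f x.
Proof.
move=> sf; have := pi_gen_lin w a x sf (schwartz0 R l).
have -> : (fun y => a * f y + 0) = (fun y => a * f y).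
  by apply/funext => y; rewrite addr0.
by rewrite pi_gen0 addr0.
Qed.

Lemma pi_gen_sum w (I : Type) (r : seq I) (F : I -> M -> R[i]) x :
  (forall i, schwartz (F i)) ->
  pi w (fun y => \sum_(i <- r) F i y) x = \sum_(i <- r) pi w (F i) x.
Proof.
move=> sF; elim: r => [|i r IH].
  rewrite big_nil -[RHS](pi_gen0 w x); congr (pi w _ x).
  by apply/funext => y; rewrite big_nil.
rewrite big_cons -IH -[pi w (F i) x]mul1r -pi_gen_lin //; last exact: schwartz_sum.
by congr (pi w _ x); apply/funext => y; rewrite mul1r big_cons.
Qed.

(** As [genL i j] acts by a linear vector field plus a scalar, its commutators
    with a coordinate and with a partial derivative are again a coordinate and
    a partial derivative, up to a factor. These four rules (for [genL] and
    [genR]) determine the commutators with all generators, whose operators are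
    sums of compositions of coordinates, partial derivatives and scalars. *)
Lemma genL_mulx i j p f x : schwartz f ->
  pi (genL i j) (mulx p f) x =
  mulx p (pi (genL i j) f) x - (i == p.1)%:R * mulx (j, p.2) f x.
Proof.
move=> sf; rewrite !genLE /=.
have -> : \sum_k mulx (j, k) (partial (i, k) (mulx p f)) x =
    \sum_k mulx p (mulx (j, k) (partial (i, k) f)) x
    + (i == p.1)%:R * mulx (j, p.2) f x.
  have -> : (i == p.1)%:R * mulx (j, p.2) f x =
      \sum_k ((i, k) == p)%:R * mulx (j, k) f x.
    rewrite (bigD1 p.2) //= big1 ?addr0 => [|k kp].
      by rewrite -pair_eqE /= eqxx andbT.
    by rewrite -pair_eqE /= (negbTE kp) andbF mul0r.
  rewrite -big_split; apply: eq_bigr => k _ /=.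
  by rewrite /mulx partial_mulx // /mulx; ring.
by rewrite /mulx -mulr_sumr; ring.
Qed.

Lemma genR_mulx i j p f x : schwartz f ->
  pi (genR i j) (mulx p f) x =
  mulx p (pi (genR i j) f) x + (j == p.2)%:R * mulx (p.1, i) f x.
Proof.
move=> sf; rewrite !genRE /=.
have -> : \sum_k mulx (k, i) (partial (k, j) (mulx p f)) x =
    \sum_k mulx p (mulx (k, i) (partial (k, j) f)) x
    + (j == p.2)%:R * mulx (p.1, i) f x.
  have -> : (j == p.2)%:R * mulx (p.1, i) f x =
      \sum_k ((k, j) == p)%:R * mulx (k, i) f x.
    rewrite (bigD1 p.1) //= big1 ?addr0 => [|k kp].
      by rewrite -pair_eqE /= eqxx.
    by rewrite -pair_eqE /= (negbTE kp) mul0r.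
  rewrite -big_split; apply: eq_bigr => k _ /=.
  by rewrite /mulx partial_mulx // /mulx; ring.
by rewrite /mulx -mulr_sumr; ring.
Qed.

Lemma genL_partial i j p f x : schwartz f ->
  pi (genL i j) (partial p f) x =
  partial p (pi (genL i j) f) x + (p.1 == j)%:R * partial (i, p.2) f x.
Proof.
move=> sf; rewrite !genLE.
have s1 k : schwartz (mulx (j, k) (partial (i, k) f)).
  exact/schwartz_mulx/schwartz_partial.
rewrite partial_lin; [|exact: schwartz_sum|exact: schwartzZ].
rewrite (partialZ p (- (weight * (i == j)%:R)) x sf) (partial_sum p _ x s1).
have -> : \sum_k partial p (mulx (j, k) (partial (i, k) f)) x =
    (p.1 == j)%:R * partial (i, p.2) f x
    + \sum_k mulx (j, k) (partial (i, k) (partial p f)) x.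
  have -> : (p.1 == j)%:R * partial (i, p.2) f x =
      \sum_k (p == (j, k))%:R * partial (i, k) f x.
    rewrite (bigD1 p.2) //= big1 ?addr0 => [|k kp].
      by rewrite -pair_eqE /= eqxx andbT.
    by rewrite -pair_eqE /= [p.2 == _]eq_sym (negbTE kp) andbF mul0r.
  rewrite -big_split; apply: eq_bigr => k _ /=.
  rewrite partial_mulx; last exact: schwartz_partial.
  by rewrite /mulx partialC.
by ring.
Qed.

Lemma genR_partial i j p f x : schwartz f ->
  pi (genR i j) (partial p f) x =
  partial p (pi (genR i j) f) x - (p.2 == i)%:R * partial (p.1, j) f x.
Proof.
move=> sf; rewrite !genRE.
have s1 k : schwartz (mulx (k, i) (partial (k, j) f)).
  exact/schwartz_mulx/schwartz_partial.
rewrite partial_lin; [|exact: schwartz_sum|exact: schwartzZ].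
rewrite (partialZ p (weight * (i == j)%:R) x sf) (partial_sum p _ x s1).
have -> : \sum_k partial p (mulx (k, i) (partial (k, j) f)) x =
    (p.2 == i)%:R * partial (p.1, j) f x
    + \sum_k mulx (k, i) (partial (k, j) (partial p f)) x.
  have -> : (p.2 == i)%:R * partial (p.1, j) f x =
      \sum_k (p == (k, i))%:R * partial (k, j) f x.
    rewrite (bigD1 p.1) //= big1 ?addr0 => [|k kp].
      by rewrite -pair_eqE /= eqxx.
    by rewrite -pair_eqE /= [p.1 == _]eq_sym (negbTE kp) mul0r.
  rewrite -big_split; apply: eq_bigr => k _ /=.
  rewrite partial_mulx; last exact: schwartz_partial.
  by rewrite /mulx partialC.
by ring.
Qed.

Lemma pi_gen_genL w k m f x : schwartz f ->
  pi w (pi (genL k m) f) x =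
  -1 * (\sum_n pi w (mulx (m, n) (partial (k, n) f)) x)
  + - (weight * (k == m)%:R) * pi w f x.
Proof.
move=> sf; have s1 n : schwartz (mulx (m, n) (partial (k, n) f)).
  exact/schwartz_mulx/schwartz_partial.
rewrite [in LHS](genLE k m) pi_gen_lin; [|exact: schwartz_sum|exact: schwartzZ].
by rewrite pi_genZ // pi_gen_sum.
Qed.

Lemma pi_gen_genR w k m f x : schwartz f ->
  pi w (pi (genR k m) f) x =
  1 * (\sum_n pi w (mulx (n, k) (partial (n, m) f)) x)
  + weight * (k == m)%:R * pi w f x.
Proof.
move=> sf; have s1 n : schwartz (mulx (n, k) (partial (n, m) f)).
  exact/schwartz_mulx/schwartz_partial.
rewrite [in LHS](genRE k m) pi_gen_lin; [|exact: schwartz_sum|exact: schwartzZ].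
by rewrite pi_genZ // pi_gen_sum.
Qed.

(** Moving [genL i j] across each term [mulx (m, n) (partial (k, n) f)] of
    [genL k m] produces one extra sum from the coordinate and one from the
    derivative; the symmetry of second derivatives enters through
    [genL_partial]. The scalar parts contribute
    [weight * ((j == k) (i == m) - (i == m) (k == j)) = 0]. *)
Lemma comm_genLL i j k m f x : schwartz f ->
  pi (genL i j) (pi (genL k m) f) x - pi (genL k m) (pi (genL i j) f) x =
  (j == k)%:R * pi (genL i m) f x - (i == m)%:R * pi (genL k j) f x.
Proof.
move=> sf; rewrite pi_gen_genL //.
have -> : \sum_n pi (genL i j) (mulx (m, n) (partial (k, n) f)) x =
    \sum_n mulx (m, n) (partial (k, n) (pi (genL i j) f)) x
    + (j == k)%:R * (\sum_n mulx (m, n) (partial (i, n) f) x)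
    - (i == m)%:R * (\sum_n mulx (j, n) (partial (k, n) f) x).
  rewrite !mulr_sumr -sumrN -!big_split; apply: eq_bigr => n _ /=.
  rewrite genL_mulx; last exact: schwartz_partial.
  by rewrite [X in X - _]/mulx genL_partial // /mulx /= [k == j]eq_sym; ring.
rewrite (genLE k m (pi _ _)) (genLE i m f) (genLE k j f) [k == j]eq_sym.
by ring.
Qed.

(** Left and right translations commute: the two extra terms, one from the
    coordinate and one from the derivative, are both [mulx (j, k) (partial (i, m) f)]
    and cancel. *)
Lemma comm_genLR i j k m f x : schwartz f ->
  pi (genL i j) (pi (genR k m) f) x - pi (genR k m) (pi (genL i j) f) x = 0.
Proof.
move=> sf; rewrite pi_gen_genR //.
have -> : \sum_n pi (genL i j) (mulx (n, k) (partial (n, m) f)) x =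
    \sum_n mulx (n, k) (partial (n, m) (pi (genL i j) f)) x.
  transitivity (\sum_n (mulx (n, k) (partial (n, m) (pi (genL i j) f)) x
    + ((n == j)%:R * mulx (n, k) (partial (i, m) f) x
      - (i == n)%:R * mulx (j, k) (partial (n, m) f) x))).
    apply: eq_bigr => n _; rewrite genL_mulx; last exact: schwartz_partial.
    by rewrite [X in X - _]/mulx genL_partial // /mulx /=; ring.
  have delta (F : 'I_l.+1 -> R[i]) i0 : \sum_n (n == i0)%:R * F n = F i0.
    rewrite (bigD1 i0) //= eqxx mul1r big1 ?addr0 // => n /negbTE->.
    by rewrite mul0r.
  rewrite !big_split sumrN /= delta.
  by under [X in _ + (_ - X)]eq_bigr do rewrite eq_sym; rewrite delta subrr addr0.
by rewrite (genRE k m (pi _ _)); ring.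
Qed.

Lemma comm_genRR i j k m f x : schwartz f ->
  pi (genR i j) (pi (genR k m) f) x - pi (genR k m) (pi (genR i j) f) x =
  (j == k)%:R * pi (genR i m) f x - (i == m)%:R * pi (genR k j) f x.
Proof.
move=> sf; rewrite pi_gen_genR //.
have -> : \sum_n pi (genR i j) (mulx (n, k) (partial (n, m) f)) x =
    \sum_n mulx (n, k) (partial (n, m) (pi (genR i j) f)) x
    + (j == k)%:R * (\sum_n mulx (n, i) (partial (n, m) f) x)
    - (i == m)%:R * (\sum_n mulx (n, k) (partial (n, j) f) x).
  rewrite !mulr_sumr -sumrN -!big_split; apply: eq_bigr => n _ /=.
  rewrite genR_mulx; last exact: schwartz_partial.
  by rewrite [X in X + _]/mulx genR_partial // /mulx /= [m == i]eq_sym; ring.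
rewrite (genRE k m (pi _ _)) (genRE i m f) (genRE k j f) [k == j]eq_sym.
by ring.
Qed.

Lemma comm_genXY i j k m f x : schwartz f ->
  pi (genX i j) (pi (genY k m) f) x - pi (genY k m) (pi (genX i j) f) x =
  ((i == k) && (j == m))%:R * pi genC f x.
Proof.
move=> sf; rewrite !genYE !genXE (partialZ _ _ _ (schwartz_mulx _ sf)).
rewrite partial_mulx // genCE /mulx -pair_eqE /= [i == k]eq_sym [j == m]eq_sym.
by ring.
Qed.

Lemma comm_genLX i j k m f x : schwartz f ->
  pi (genL i j) (pi (genX k m) f) x - pi (genX k m) (pi (genL i j) f) x =
  - ((i == k)%:R * pi (genX j m) f x).
Proof.
move=> sf; rewrite !genXE pi_genZ; last exact: schwartz_mulx.
by rewrite genL_mulx //=; ring.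
Qed.

Lemma comm_genRX i j k m f x : schwartz f ->
  pi (genR i j) (pi (genX k m) f) x - pi (genX k m) (pi (genR i j) f) x =
  (j == m)%:R * pi (genX k i) f x.
Proof.
move=> sf; rewrite !genXE pi_genZ; last exact: schwartz_mulx.
by rewrite genR_mulx //=; ring.
Qed.

Lemma comm_genLY i j k m f x : schwartz f ->
  pi (genL i j) (pi (genY k m) f) x - pi (genY k m) (pi (genL i j) f) x =
  (j == k)%:R * pi (genY i m) f x.
Proof.
move=> sf; rewrite !genYE pi_genZ; last exact: schwartz_partial.
by rewrite genL_partial //= [k == j]eq_sym; ring.
Qed.

Lemma comm_genRY i j k m f x : schwartz f ->
  pi (genR i j) (pi (genY k m) f) x - pi (genY k m) (pi (genR i j) f) x =
  - ((i == m)%:R * pi (genY k j) f x).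
Proof.
move=> sf; rewrite !genYE pi_genZ; last exact: schwartz_partial.
by rewrite genR_partial //= [m == i]eq_sym; ring.
Qed.

End LieAction.

(** * The module structure over the Lie algebra *)

Section LieModule.
Variables (R : realType) (l : nat) (kappa c : R).
Local Notation M := 'M[R]_l.+1.
Local Notation pi := (@pi_gen R l kappa c).
Local Notation pih := (@pi_hgl R l kappa c).
Implicit Types (f h : M -> R[i]) (x : M) (a : R[i]) (w u v : hgl_gen l)
  (U V : hgl R l).
Local Arguments pi_gen : simpl never.

Lemma pi_hgl_linl (r : R) U V f x :
  pih (r *: U + V) f x = r%:C * pih U f x + pih V f x.
Proof.
rewrite /pi_hgl mulr_sumr -big_split; apply: eq_bigr => w _ /=.
by rewrite !ffunE /= rmorphD rmorphM mulrDl mulrA.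
Qed.

Lemma pi_hgl0 f x : pih 0 f x = 0.
Proof. by rewrite /pi_hgl big1 // => w _; rewrite ffunE mul0r. Qed.

Lemma pi_hglZ (r : R) U f x : pih (r *: U) f x = r%:C * pih U f x.
Proof. by rewrite -[r *: U]addr0 pi_hgl_linl pi_hgl0 addr0. Qed.

Lemma pi_hglD U V f x : pih (U + V) f x = pih U f x + pih V f x.
Proof. by rewrite -{1}[U]scale1r pi_hgl_linl mul1r. Qed.

Lemma pi_hglN U f x : pih (- U) f x = - pih U f x.
Proof. by rewrite -scaleN1r pi_hglZ rmorphN rmorph1 mulN1r. Qed.

Lemma pi_hgl_sum (I : Type) (r : seq I) (F : I -> hgl R l) f x :
  pih (\sum_(i <- r) F i) f x = \sum_(i <- r) pih (F i) f x.
Proof.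
elim: r => [|i r IH]; first by rewrite !big_nil pi_hgl0.
by rewrite !big_cons pi_hglD IH.
Qed.

Lemma pi_hgl_elt w f x : pih (hgl_elt R w) f x = pi w f x.
Proof.
rewrite /pi_hgl (bigD1 w) //= ffunE eqxx mul1r big1 ?addr0 // => v vw.
by rewrite ffunE (negbTE vw) mul0r.
Qed.

Lemma schwartz_pi_hgl U f : schwartz f -> schwartz (pih U f).
Proof. by move=> sf; apply: schwartz_sum => w; exact/schwartzZ/schwartz_pi_gen. Qed.

Lemma pi_hgl_linr U a f h x : schwartz f -> schwartz h ->
  pih U (fun y => a * f y + h y) x = a * pih U f x + pih U h x.
Proof.
move=> sf sh; rewrite /pi_hgl mulr_sumr -big_split; apply: eq_bigr => w _ /=.
by rewrite pi_gen_lin // mulrDr mulrCA.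
Qed.

(** Halves the case analysis in [pi_gen_bracket]. *)
Lemma gen_bracketC u v : gen_bracket R u v = - gen_bracket R v u.
Proof.
case: u => [i j|i j|i j|i j|]; case: v => [k m|k m|k m|k m|];
  rewrite /= ?opprK ?oppr0 //.
- by rewrite opprB [k == j]eq_sym [m == i]eq_sym [i == m]eq_sym.
- by rewrite opprB [k == j]eq_sym [m == i]eq_sym [i == m]eq_sym.
Qed.

Lemma pi_gen_bracket u v f x : schwartz f ->
  pih (gen_bracket R u v) f x = pi u (pi v f) x - pi v (pi u f) x.
Proof.
move=> sf.
have nc (b : bool) : (b%:R : R)%:C = b%:R :> R[i] by case: b.
have swap : pih (gen_bracket R v u) f x = pi v (pi u f) x - pi u (pi v f) x ->
    pih (gen_bracket R u v) f x = pi u (pi v f) x - pi v (pi u f) x.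
  by move=> E; rewrite gen_bracketC pi_hglN E opprB.
have central w : pi w (pi genC f) x - pi genC (pi w f) x = 0.
  by rewrite [pi genC f]genCE pi_genZ // genCE subrr.
have cXX i j k m : pi (genX i j) (pi (genX k m) f) x =
    pi (genX k m) (pi (genX i j) f) x.
  by rewrite !genXE /mulx; ring.
have cYY i j k m : pi (genY i j) (pi (genY k m) f) x =
    pi (genY k m) (pi (genY i j) f) x.
  rewrite !genYE (partialZ _ _ _ (schwartz_partial _ sf)).
  by rewrite (partialZ _ _ _ (schwartz_partial _ sf)) partialC.
have E := (pi_hglD, pi_hglN, pi_hglZ, pi_hgl_elt, pi_hgl0, nc).
case: u v swap => [i j|i j|i j|i j|] [k m|k m|k m|k m|] swap.
- by rewrite /= !E comm_genLL //.
- by rewrite /= !E comm_genLR //.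
- by rewrite /= !E comm_genLX //.
- by rewrite /= !E comm_genLY //.
- by rewrite /= !E central.
- by apply: swap; rewrite /= !E comm_genLR //.
- by rewrite /= !E comm_genRR //.
- by rewrite /= !E comm_genRX //.
- by rewrite /= !E comm_genRY //.
- by rewrite /= !E central.
- by apply: swap; rewrite /= !E comm_genLX //.
- by apply: swap; rewrite /= !E comm_genRX //.
- by rewrite /= !E cXX subrr.
- by rewrite /= !E comm_genXY //.
- by rewrite /= !E central.
- by apply: swap; rewrite /= !E comm_genLY //.
- by apply: swap; rewrite /= !E comm_genRY //.
- by apply: swap; rewrite /= !E comm_genXY //.
- by rewrite /= !E cYY subrr.
- by rewrite /= !E central.
- by apply: swap; rewrite /= !E central.
- by apply: swap; rewrite /= !E central.
- by apply: swap; rewrite /= !E central.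
- by apply: swap; rewrite /= !E central.
- by rewrite /= !E subrr.
Qed.

Lemma is_hgl_module_pi_hgl : is_hgl_module pih.
Proof.
split=> [|||U V f x sf].
- exact: schwartz_pi_hgl.
- exact: pi_hgl_linr.
- by move=> *; exact: pi_hgl_linl.
- have comp (S T : hgl R l) :
      pih S (pih T f) x = \sum_u \sum_v (S u * T v)%:C * pi u (pi v f) x.
    apply: eq_bigr => u _.
    rewrite pi_gen_sum => [|v]; last exact/schwartzZ/schwartz_pi_gen.
    rewrite mulr_sumr; apply: eq_bigr => v _.
    by rewrite pi_genZ ?mulrA ?rmorphM //; exact: schwartz_pi_gen.
  rewrite !comp [X in _ - X]exchange_big /hgl_bracket pi_hgl_sum -sumrB.
  apply: eq_bigr => u _; rewrite pi_hgl_sum -sumrB; apply: eq_bigr => v _.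
  by rewrite pi_hglZ pi_gen_bracket // [V v * U u]mulrC mulrBr.
Qed.
End LieModule.

(** * Determinants and inverses along one-parameter families *)

Section Curves.
Variables (R : realType) (n : nat).
Local Notation M := 'M[R]_n.+1.
Implicit Types (A B x : M) (t : R).

(** The polynomial [t ^ (n + 1) * chi (1 / t)] with [chi] the characteristic
    polynomial of [- A]; by [det_one_plus] it computes [det (1 + t A)]. *)
Definition reversed_char_poly A : {poly R} :=
  \poly_(k < n.+2) (char_poly (- A))`_(n.+1 - k).

Lemma det_one_plus A t :
  \det (1%:M + t *: A) = (reversed_char_poly A).[t].
Proof.
have [->|t0] := eqVneq t 0.
  rewrite scale0r addr0 det1 horner_coef0 coef_poly subn0.
  have /monicP := char_poly_monic (- A).
  by rewrite lead_coefE size_char_poly.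
have -> : 1%:M + t *: A = t *: (t^-1%:M - - A).
  by rewrite opprK scalerDr scale_scalar_mx divff.
rewrite detZ.
have -> : \det (t^-1%:M - - A) = (char_poly (- A)).[t^-1].
  rewrite -[RHS]/(horner_eval t^-1 _) -det_map_mx; congr (\det _).
  apply/matrixP => i j; rewrite !mxE /= horner_evalE.
  by rewrite hornerD hornerN hornerC hornerMn hornerX.
rewrite (@horner_coef_wide _ n.+2) ?size_char_poly // horner_poly mulr_sumr.
rewrite (reindex_inj rev_ord_inj) /=; apply: eq_bigr => k _.
rewrite subSS mulrCA; congr (_ * _).
have kn : (k <= n.+1)%N by rewrite -ltnS.
by rewrite exprVn -expfB_cond ?subKn // (negbTE t0) add0n leq_subr.
Qed.

Lemma reversed_char_poly_horner0 A : (reversed_char_poly A).[0] = 1.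
Proof. by rewrite -det_one_plus scale0r addr0 det1. Qed.

(** Jacobi's formula at the identity. The linear coefficient of the reversed
    polynomial is the subleading coefficient of the characteristic polynomial
    of [- A], which is [- tr (- A)]. *)
Lemma reversed_char_poly_deriv0 A : (reversed_char_poly A)^`().[0] = \tr A.
Proof.
rewrite horner_coef0 coef_deriv coef_poly /= subn1 -[n]/(n.+1.-1).
by rewrite char_poly_trace // linearN opprK.
Qed.

Lemma near0_det_gt0 A : \forall t \near (0 : R), 0 < \det (1%:M + t *: A).
Proof.
have := @continuous_horner R (reversed_char_poly A) 0.
move/cvgrPdist_lt => /(_ 1 ltr01); apply: filterS => t.
rewrite reversed_char_poly_horner0 det_one_plus => /ltr_normlP[_].
by rewrite ltrBlDr -ltrBlDl subrr.
Qed.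

Lemma near0_unitmx A : \forall t \near (0 : R), 1%:M + t *: A \in unitmx.
Proof.
by apply: filterS (near0_det_gt0 A) => t; rewrite unitmxE unitfE => /lt0r_neq0.
Qed.

(** The difference quotient of [t * h t] at 0 is [h] itself, so that continuity
    of [h] makes up for the missing derivative. *)
Lemma is_derive_mul_id (h : R -> R) : {for 0, continuous h} ->
  is_derive (0 : R) 1 (fun t => t * h t) (h 0).
Proof.
move=> ch.
have E : ((fun s : R => s^-1 *: (((fun t => t * h t) \o shift 0) (s *: 1) - 0 * h 0))
    @ 0^' --> h 0)%classic.
  have ch' : (h @ 0^' --> h 0)%classic by apply: cvg_within_filter; exact: ch.
  apply: cvg_trans ch'; apply: near_eq_cvg.
  near=> s; rewrite /= mul0r subr0 addr0 [s *: 1]mulr1 /GRing.scale /= mulKf //.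
  by near: s; exact: nbhs_dnbhs_neq.
by split; [apply/cvg_ex; exists (h 0)|exact: cvg_lim].
Unshelve. all: by end_near. Qed.

Lemma is_derive_mx0 (C : R -> M) (D : M) :
  (forall i j, is_derive (0 : R) 1 (fun t => C t i j) (D i j)) ->
  is_derive (0 : R) 1 C D.
Proof.
move=> dC; have dv : derivable C 0 1 by apply/derivable_mxP => i j; case: (dC i j).
split=> //; rewrite derive_mx //; apply/matrixP => i j; rewrite mxE.
by case: (dC i j).
Qed.

(** The orbit of [x] under [(1 + t A, 1 + t B)]. *)
Definition curve A B x t : M := invmx (1%:M + t *: A) *m x *m (1%:M + t *: B).

Lemma curve0 A B x : curve A B x 0 = x.
Proof. by rewrite /curve !scale0r !addr0 invmx1 mul1mx mulmx1. Qed.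

(** Writes the curve as [x + t h (t)] with [h] involving the curve itself, so that
    its derivative at 0 follows from its mere continuity there. *)
Lemma curve_fixed_point A B x t : 1%:M + t *: A \in unitmx ->
  curve A B x t = x + t *: (x *m B - A *m curve A B x t).
Proof.
move=> uA; have : (1%:M + t *: A) *m curve A B x t = x *m (1%:M + t *: B).
  by rewrite /curve -!mulmxA mulKVmx.
rewrite mulmxDl mulmxDr mul1mx mulmx1 -scalemxAl -scalemxAr => E.
by rewrite scalerBr addrA -E addrK.
Qed.

(** By Cramer's rule the entries are, near [t = 0], quotients of polynomials in
    [t] with denominator [det (1 + t A)], which equals 1 at [t = 0]. *)
Lemma curve_continuous A B x i j :
  {for 0, continuous (fun t => (A *m curve A B x t) i j)}.
Proof.
pose P (D : M) : 'M[{poly R}]_n.+1 := map_mx polyC D.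
pose N := P A *m (\adj (1%:M + 'X *: P A) *m P x *m (1%:M + 'X *: P B)).
have lin_eval D t : map_mx (horner_eval t) (1%:M + 'X *: P D) = 1%:M + t *: D.
  apply/matrixP => k m; rewrite !mxE /= horner_evalE hornerD hornerM hornerX hornerC.
  by rewrite hornerMn hornerC.
have cst_eval D t : map_mx (horner_eval t) (P D) = D.
  by apply/matrixP => k m; rewrite !mxE /= horner_evalE hornerC.
have E : \forall t \near (0 : R), (reversed_char_poly A).[t]^-1 * (N i j).[t] =
    (A *m curve A B x t) i j.
  apply: filterS (near0_unitmx A) => t uA.
  rewrite /curve /invmx uA -det_one_plus -!scalemxAl -scalemxAr [in RHS]mxE; congr (_ * _).
  have -> : (N i j).[t] = map_mx (horner_eval t) N i j by rewrite [RHS]mxE.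
  by rewrite /N !map_mxM map_mx_adj !lin_eval !cst_eval.
have cd : ((fun t => (reversed_char_poly A).[t]^-1) @ (0 : R) -->
    (reversed_char_poly A).[0]^-1)%classic.
  apply: cvgV; last exact: continuous_horner.
  by rewrite reversed_char_poly_horner0 oner_neq0.
have cN : ((fun t => (N i j).[t]) @ (0 : R) --> (N i j).[0])%classic.
  exact: continuous_horner.
have cdN := cvgM cd cN; rewrite (nbhs_singleton E) in cdN.
suff : ((fun t => (A *m curve A B x t) i j) @ (0 : R) -->
    (A *m curve A B x 0) i j)%classic by [].
exact: (cvg_trans (near_eq_cvg E) (cdN _)).
Qed.

Lemma is_derive_curve A B x :
  is_derive (0 : R) 1 (curve A B x) (x *m B - A *m x).
Proof.
apply: is_derive_mx0 => i j.
pose h t := (x *m B) i j - (A *m curve A B x t) i j.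
have ch : {for 0, continuous h}.
  by apply: cvgB; [exact: cvg_cst|exact: curve_continuous].
have -> : (x *m B - A *m x) i j = 0 + h 0 by rewrite add0r /h curve0 !mxE.
apply: (@near_eq_is_derive _ _ _ (cst (x i j) + (fun t => t * h t))).
  apply: filterS (near0_unitmx A) => t uA.
  rewrite [in RHS]curve_fixed_point // [RHS]mxE; congr (_ + _).
  rewrite [RHS]mxE; congr (_ * _); rewrite [RHS]mxE; congr (_ + _).
  by rewrite [RHS]mxE.
by apply: is_deriveD; exact: is_derive_mul_id.
Qed.

Lemma is_derive_ln_det A B :
  is_derive (0 : R) 1
    (fun t => ln `|\det (invmx (1%:M + t *: A) *m (1%:M + t *: B))|)
    (\tr B - \tr A).
Proof.
pose a := reversed_char_poly A; pose b := reversed_char_poly B.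
have a0 : a.[0] = 1 by exact: reversed_char_poly_horner0.
have b0 : b.[0] = 1 by exact: reversed_char_poly_horner0.
have da : is_derive (0 : R) 1 (horner a) (\tr A).
  by rewrite -reversed_char_poly_deriv0; exact: is_derive_poly.
have db : is_derive (0 : R) 1 (horner b) (\tr B).
  by rewrite -reversed_char_poly_deriv0; exact: is_derive_poly.
have dla : is_derive (0 : R) 1 (@ln R \o horner a) (\tr A).
  rewrite -[\tr A]mul1r; apply: is_derive1_comp; rewrite a0 -[X in is_derive _ _ _ X]invr1.
  exact: is_derive1_ln.
have dlb : is_derive (0 : R) 1 (@ln R \o horner b) (\tr B).
  rewrite -[\tr B]mul1r; apply: is_derive1_comp; rewrite b0 -[X in is_derive _ _ _ X]invr1.
  exact: is_derive1_ln.
have := is_deriveB dlb dla.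
apply: near_eq_is_derive; near=> t.
have A0 : 0 < \det (1%:M + t *: A) by near: t; exact: near0_det_gt0.
have B0 : 0 < \det (1%:M + t *: B) by near: t; exact: near0_det_gt0.
rewrite det_mulmx det_inv normrM normfV !gtr0_norm // lnM ?posrE ?invr_gt0 //.
by rewrite lnV ?posrE // addrC !det_one_plus.
Unshelve. all: by end_near. Qed.

Lemma is_derive_along_curve (g : M -> R) (C : R -> M) (v : M) :
  differentiable g (C 0) -> is_derive (0 : R) 1 C v ->
  is_derive (0 : R) 1 (fun t => g (C t)) ('D_v g (C 0)).
Proof.
move=> dg [dC vC]; have dC' := (derivable1_diffP _ _).1 dC.
split; first exact/derivable1_diffP/(differentiable_comp dC' dg).
rewrite (deriveE _ (differentiable_comp dC' dg)) (diff_comp dC' dg) /=.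
by rewrite -(deriveE _ dC') vC -(deriveE _ dg).
Qed.

End Curves.

(** * The group action *)

Section GroupAction.
Variables (R : realType).
Local Notation Re := complex.Re.
Local Notation Im := complex.Im.

Lemma cpowDr (t : R) (z w : R[i]) : cpow t (z + w) = cpow t z * cpow t w.
Proof.
rewrite /cpow ReD ImD 2!mulrDl expRD cosD sinD rmorphM /=.
rewrite mulrACA; congr (_ * _); apply: complex_eq => /=; ring.
Qed.

Lemma cpowM (s t : R) (z : R[i]) : 0 < s -> 0 < t ->
  cpow (s * t) z = cpow s z * cpow t z.
Proof.
move=> s0 t0; rewrite /cpow lnM ?posrE // 2!mulrDr expRD cosD sinD rmorphM /=.
rewrite mulrACA; congr (_ * _); apply: complex_eq => /=; ring.
Qed.

Lemma cpow1 (z : R[i]) : cpow 1 z = 1.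
Proof. by rewrite /cpow ln1 !mulr0 expR0 cos0 sin0 mul1r. Qed.

Variables (l : nat) (kappa c : R).
Local Notation M := 'M[R]_l.+1.
Implicit Types (f : M -> R[i]) (g h A B x : M).

Lemma pi_glE g1 g2 f x : pi_gl kappa g1 g2 f x =
  cpow `|\det (invmx g1 *m g2)| (weight l kappa) * f (invmx g1 *m x *m g2).
Proof. by rewrite /pi_gl /weight addrC. Qed.

Lemma schwartz_pi_gl g1 g2 f : g1 \in unitmx -> g2 \in unitmx ->
  schwartz f -> schwartz (pi_gl kappa g1 g2 f).
Proof.
move=> u1 u2 sf; apply: schwartzZ; apply: schwartz_translate => //.
by rewrite unitmx_inv.
Qed.

Lemma invmxM g h : g \in unitmx -> h \in unitmx ->
  invmx (g *m h) = invmx h *m invmx g.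
Proof. by move=> ug uh; exact: (invrM ug uh). Qed.

Lemma normr_det_gt0 g : g \in unitmx -> 0 < `|\det g|.
Proof. by rewrite unitmxE unitfE normr_gt0. Qed.

Lemma is_GLxGL_module_pi_gl : is_GLxGL_module (pi_gl (l := l) kappa).
Proof.
split=> [g1 g2 f u1 u2 sf|g1 g2 a f h x _ _ _ _|f x _|g1 g2 h1 h2 f x ug1 ug2 uh1 uh2 _].
- exact: schwartz_pi_gl.
- by rewrite /pi_gl mulrDr mulrCA.
- by rewrite /pi_gl invmx1 !mul1mx mulmx1 det1 normr1 cpow1 mul1r.
- have upos (g h : M) : g \in unitmx -> h \in unitmx -> 0 < `|\det (invmx g *m h)|.
    by move=> ug uh; rewrite normr_det_gt0 // unitmx_mul unitmx_inv ug.
  have detE : `|\det (invmx (g1 *m h1) *m (g2 *m h2))| =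
      `|\det (invmx g1 *m g2)| * `|\det (invmx h1 *m h2)|.
    by rewrite -normrM invmxM // !det_mulmx; congr `|_|; ring.
  rewrite /pi_gl detE (cpowM _ (upos _ _ ug1 ug2) (upos _ _ uh1 uh2)) invmxM //.
  by rewrite !mulmxA mulrA.
Qed.

Lemma pi_gl_twist g1 g2 f x :
  pi_gl kappa g1 g2 f x = pi_kappa kappa g1 g2 * pi_gl 0 g1 g2 f x.
Proof.
rewrite /pi_gl /pi_kappa mulrA -cpowDr.
by rewrite (_ : (0 : R)%:C = 0) // mulr0 add0r.
Qed.

Lemma sum_hgl_gen (V : nmodType) (F : hgl_gen l -> V) :
  \sum_w F w = \sum_p F (genL p.1 p.2) + \sum_p F (genR p.1 p.2)
    + (\sum_p F (genX p.1 p.2) + \sum_p F (genY p.1 p.2)) + F genC.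
Proof.
rewrite (reindex (@hgl_gen_decode l)) /=; last first.
  exists (@hgl_gen_code l) => [w _|w _]; last exact: hgl_gen_codeK.
  by case: w => [[[[]|[]]|[[]|[]]]|[]].
rewrite !big_sumType /=; congr (_ + _).
by rewrite (big_pred1 tt) // => -[].
Qed.

(** An element [(A, B)] of the two copies of gl acts by the vector field with value
    [x B - A x] at [x], the velocity of the orbit of [x], plus a scalar
    proportional to [tr B - tr A]. *)
Lemma pi_hgl_of_gl A B f x :
  pi_hgl kappa c (hgl_of_gl A B) f x =
  weight l kappa * (\tr B - \tr A)%:C * f x
  + \sum_p ((x *m B - A *m x) p.1 p.2)%:C * partial p f x.
Proof.
rewrite /pi_hgl sum_hgl_gen.
rewrite [X in _ + (X + _) + _]big1 => [|p _]; last by rewrite ffunE mul0r.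
rewrite [X in _ + (_ + X) + _]big1 => [|p _]; last by rewrite ffunE mul0r.
rewrite ffunE mul0r !addr0.
have trE (D : M) : (\tr D)%:C = \sum_p (D p.1 p.2)%:C * (p.1 == p.2)%:R.
  rewrite -(pair_bigA _ (fun i j => (D i j)%:C * (i == j)%:R)) /=.
  rewrite rmorph_sum; apply: eq_bigr => i _.
  rewrite (bigD1 i) //= eqxx mulr1 big1 ?addr0 // => j ji.
  by rewrite eq_sym (negbTE ji) mulr0.
have LE : \sum_p (hgl_of_gl A B (genL p.1 p.2))%:C * pi_gen kappa c (genL p.1 p.2) f x =
    - (\sum_p ((A *m x) p.1 p.2)%:C * partial p f x)
    - weight l kappa * (\tr A)%:C * f x.
  rewrite trE mulr_sumr mulr_suml.
  have -> : \sum_p ((A *m x) p.1 p.2)%:C * partial p f x =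
      \sum_p (A p.1 p.2)%:C * \sum_k mulx (p.2, k) (partial (p.1, k) f) x.
    rewrite -(pair_bigA _ (fun i j => ((A *m x) i j)%:C * partial (i, j) f x)) /=.
    rewrite -(pair_bigA _ (fun i j => (A i j)%:C *
      \sum_k mulx (j, k) (partial (i, k) f) x)) /=.
    apply: eq_bigr => i _.
    under eq_bigr do rewrite mxE rmorph_sum mulr_suml.
    under [RHS]eq_bigr do rewrite mulr_sumr.
    rewrite exchange_big; apply: eq_bigr => j _; apply: eq_bigr => k _.
    by rewrite rmorphM /mulx mulrA.
  rewrite -sumrN -sumrN -big_split; apply: eq_bigr => p _.
  by rewrite ffunE genLE /=; ring.
have RE : \sum_p (hgl_of_gl A B (genR p.1 p.2))%:C * pi_gen kappa c (genR p.1 p.2) f x =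
    \sum_p ((x *m B) p.1 p.2)%:C * partial p f x
    + weight l kappa * (\tr B)%:C * f x.
  rewrite trE mulr_sumr mulr_suml.
  have -> : \sum_p ((x *m B) p.1 p.2)%:C * partial p f x =
      \sum_p (B p.1 p.2)%:C * \sum_k mulx (k, p.1) (partial (k, p.2) f) x.
    rewrite -(pair_bigA _ (fun i j => ((x *m B) i j)%:C * partial (i, j) f x)) /=.
    rewrite -(pair_bigA _ (fun i j => (B i j)%:C *
      \sum_k mulx (k, i) (partial (k, j) f) x)) /=.
    rewrite exchange_big [RHS]exchange_big; apply: eq_bigr => j _.
    under eq_bigr do rewrite mxE rmorph_sum mulr_suml.
    under [RHS]eq_bigr do rewrite mulr_sumr.
    rewrite exchange_big; apply: eq_bigr => i _; apply: eq_bigr => k _.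
    by rewrite rmorphM /mulx /=; ring.
  rewrite -big_split; apply: eq_bigr => p _.
  by rewrite ffunE genRE /=; ring.
rewrite LE RE rmorphB /=.
have -> : \sum_p ((x *m B - A *m x) p.1 p.2)%:C * partial p f x =
    \sum_p ((x *m B) p.1 p.2)%:C * partial p f x
    - \sum_p ((A *m x) p.1 p.2)%:C * partial p f x.
  rewrite -sumrN -big_split; apply: eq_bigr => p _ /=.
  by rewrite [X in X%:C * _]mxE [X in (_ + X)%:C * _]mxE rmorphB mulrBl.
by ring.
Qed.

End GroupAction.

(** * Differentiating the group action *)

Section Integration.
Variables (R : realType) (l : nat) (kappa c : R).
Local Notation M := 'M[R]_l.+1.
Local Notation Re := complex.Re.
Local Notation Im := complex.Im.
Implicit Types (f : M -> R[i]) (A B x v : M).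

Lemma Re_sum_partial v f x : rschwartz (fun y => Re (f y)) ->
  Re (\sum_p (v p.1 p.2)%:C * partial p f x) = 'D_v (fun y => Re (f y)) x.
Proof.
move=> sf; rewrite (derive_coords v (rschwartz_diff x sf)).
rewrite (big_morph (@complex.Re R) (@ReD R) (erefl _)).
by apply: eq_bigr => p _; rewrite ReM /= mul0r subr0.
Qed.

Lemma Im_sum_partial v f x : rschwartz (fun y => Im (f y)) ->
  Im (\sum_p (v p.1 p.2)%:C * partial p f x) = 'D_v (fun y => Im (f y)) x.
Proof.
move=> sf; rewrite (derive_coords v (rschwartz_diff x sf)).
rewrite (big_morph (@complex.Im R) (@ImD R) (erefl _)).
by apply: eq_bigr => p _; rewrite ImM /= mul0r addr0.
Qed.

(** The product rule for [|det|^weight * f (curve)]. The logarithm of the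
    determinant factor has derivative [tr B - tr A] and the curve has velocity
    [x B - A x], which are the two terms of [pi_hgl_of_gl]. The complex power is
    split into a real exponential, a cosine and a sine of that logarithm. *)
Lemma integrates_pi_gl :
  integrates (pi_hgl (l := l) kappa c) (pi_gl (l := l) kappa).
Proof.
move=> A B f x /schwartzP[fr fi].
pose rho t := ln `|\det (invmx (1%:M + t *: A) *m (1%:M + t *: B))|.
move Ez : (weight l kappa) => z; pose d := \tr B - \tr A; pose V := x *m B - A *m x.
have rho0 : rho 0 = 0.
  by rewrite /rho !scale0r !addr0 invmx1 mulmx1 det1 normr1 ln1.
have drho : is_derive (0 : R) 1 rho d by exact: is_derive_ln_det.
have chain (h : R -> R) (k b : R) : is_derive (k * rho 0) 1 h b ->
    is_derive (0 : R) 1 (fun t => h (k * rho t)) (b * (k * d)).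
  move=> dh; have dk : is_derive (0 : R) 1 (fun t => k * rho t) (k * d).
    exact: is_deriveZ.
  exact: (@is_derive1_comp R h (fun t => k * rho t)).
pose e t := expR (Re z * rho t); pose co t := cos (Im z * rho t).
pose si t := sin (Im z * rho t).
have de : is_derive (0 : R) 1 e (Re z * d).
  have := chain _ (Re z) _ (is_derive_expR (Re z * rho 0)).
  by rewrite rho0 mulr0 expR0 mul1r.
have dco : is_derive (0 : R) 1 co 0.
  have := chain _ (Im z) _ (is_derive_cos (Im z * rho 0)).
  by rewrite rho0 mulr0 sin0 oppr0 mul0r.
have dsi : is_derive (0 : R) 1 si (Im z * d).
  have := chain _ (Im z) _ (is_derive_sin (Im z * rho 0)).
  by rewrite rho0 mulr0 cos0 mul1r.
have e0 : e 0 = 1 by rewrite /e rho0 mulr0 expR0.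
have co0 : co 0 = 1 by rewrite /co rho0 mulr0 cos0.
have si0 : si 0 = 0 by rewrite /si rho0 mulr0 sin0.
pose u t := Re (f (curve A B x t)); pose w t := Im (f (curve A B x t)).
have dC := is_derive_curve A B x.
have du : is_derive (0 : R) 1 u ('D_V (fun y => Re (f y)) x).
  have := is_derive_along_curve (rschwartz_diff (curve A B x 0) fr) dC.
  by rewrite curve0.
have dw : is_derive (0 : R) 1 w ('D_V (fun y => Im (f y)) x).
  have := is_derive_along_curve (rschwartz_diff (curve A B x 0) fi) dC.
  by rewrite curve0.
have u0 : u 0 = Re (f x) by rewrite /u curve0.
have w0 : w 0 = Im (f x) by rewrite /w curve0.
have dec := is_deriveM de dco; have des := is_deriveM de dsi.
rewrite pi_hgl_of_gl Ez -/d -/V.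
split.
- have -> : (fun t => Re (pi_gl kappa (1%:M + t *: A) (1%:M + t *: B) f x)) =
      e * co * u - e * si * w.
    apply/funext => t; rewrite pi_glE Ez /cpow ReM ReM ImM /= !mul0r subr0 addr0.
    by [].
  apply: (is_derive_eq (is_deriveB (is_deriveM dec du) (is_deriveM des dw))).
  rewrite ReD Re_sum_partial // ReM ReM ImM /GRing.scale /=.
  rewrite -![(_ * _ : R -> R) 0]/(_ * _) e0 co0 si0 u0 w0; ring.
- have -> : (fun t => Im (pi_gl kappa (1%:M + t *: A) (1%:M + t *: B) f x)) =
      e * co * w + e * si * u.
    apply/funext => t; rewrite pi_glE Ez /cpow ImM ReM ImM /= !mul0r subr0 addr0.
    by [].
  apply: (is_derive_eq (is_deriveD (is_deriveM dec dw) (is_deriveM des du))).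
  rewrite ImD Im_sum_partial // ImM ReM ImM /GRing.scale /=.
  rewrite -![(_ * _ : R -> R) 0]/(_ * _) e0 co0 si0 u0 w0; ring.
Qed.
End Integration.

(** * The spherical and the Whittaker vectors *)

Section Vectors.
Variables (R : realType) (l : nat) (kappa c : R).
Local Notation M := 'M[R]_l.+1.
Local Notation phi := (@spherical_vector R l c).
Local Notation psi := (@whittaker_vector R l).
Local Notation pih := (@pi_hgl R l kappa c).

Lemma schwartz_spherical_vector : 0 < c -> schwartz phi.
Proof.
move=> c_gt0; apply/schwartzP; split; last exact: rschwartz0.
by apply: rschwartz_gaussian; rewrite invr_gt0 mulr_gt0.
Qed.

Lemma partial_spherical_vector p x : 0 < c ->
  partial p phi x = (- c^-1)%:C * mulx p phi x.
Proof.
move=> c_gt0.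
have E : rpartial p (gaussian (2 * c)^-1) x = - c^-1 * (x p.1 p.2 * gaussian (2 * c)^-1 x).
  by rewrite rpartial_gaussian; field; exact: lt0r_neq0.
apply: complex_eq; rewrite /partial /mulx ?ReM ?ImM /=.
- by rewrite !mul0r ?mulr0 !subr0 -E.
- by rewrite !mul0r ?mulr0 ?addr0 ?mulr0; exact: derive_cst.
Qed.

Lemma pi_hgl_eltD u v f x :
  pih (hgl_elt R u + hgl_elt R v) f x = pi_gen kappa c u f x + pi_gen kappa c v f x.
Proof. by rewrite pi_hglD; congr (_ + _); exact: pi_hgl_elt. Qed.

Lemma pi_hgl_eltB u v f x :
  pih (hgl_elt R u - hgl_elt R v) f x = pi_gen kappa c u f x - pi_gen kappa c v f x.
Proof.
by rewrite pi_hglD pi_hglN; congr (_ - _); exact: pi_hgl_elt.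
Qed.

(** The equations of [partial_spherical_vector] turn every derivative of the
    Gaussian into a coordinate. The relation between [genX] and [genY] becomes
    [- c * (- 1 / c) = 1], and up to their scalar parts [genL i j] and [genR i j]
    become entries of [x x^T] and [x^T x], which are symmetric. *)
Lemma is_spherical_spherical_vector : 0 < c -> is_spherical pih phi.
Proof.
move=> c_gt0.
have cV : - c%:C * (- c^-1)%:C = 1 :> R[i].
  by rewrite -rmorphN -rmorphM mulrNN divff // lt0r_neq0.
have df p x := partial_spherical_vector p x c_gt0.
move: phi df => f df.
split=> i j x.
- rewrite [LHS]pi_hgl_elt [X in _ = _ * X]pi_hgl_elt.
  rewrite genXE genYE (df (i, j)).
  by rewrite [- c%:C * _]mulrA cV mul1r.
- rewrite pi_hgl_eltB !genLE.
  have -> : \sum_k mulx (j, k) (partial (i, k) f) x =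
      \sum_k mulx (i, k) (partial (j, k) f) x.
    apply: eq_bigr => k _; rewrite /mulx (df (i, k)) (df (j, k)) /mulx /=.
    by ring.
  by rewrite [j == i]eq_sym subrr.
- rewrite pi_hgl_eltB !genRE.
  have -> : \sum_k mulx (k, i) (partial (k, j) f) x =
      \sum_k mulx (k, j) (partial (k, i) f) x.
    apply: eq_bigr => k _; rewrite /mulx (df (k, i)) (df (k, j)) /mulx /=.
    by ring.
  by rewrite [j == i]eq_sym subrr.
Qed.

Lemma tempered_whittaker_vector : tempered psi.
Proof.
split=> //; exists [:: ([::], [::])], 1 => f [_ /(_ [::] [::]) bf].
rewrite big_seq1 mul1r /seminorm; apply: ub_le_sup => //.
by exists 1%:M => //=; rewrite /monomial big_nil mul1r.
Qed.

(** At the identity matrix the coordinate [x i j] is [(i == j)%:R], and the vector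
    fields of [genL i j] and [genR i j] are opposite: they generate left and
    right translations, so their sum generates conjugations, which fix the
    identity. *)
Lemma is_whittaker_whittaker_vector :
  is_whittaker (pi_hgl_dual kappa c) psi.
Proof.
have delta (F : 'I_l.+1 -> R[i]) i0 : \sum_n ((n == i0)%:R : R)%:C * F n = F i0.
  rewrite (bigD1 i0) //= eqxx mul1r big1 ?addr0 // => n /negbTE->.
  by rewrite mul0r.
split=> i j f sf; rewrite /pi_hgl_dual /psi /conj_fun.
- rewrite pi_hgl_elt genXE /mulx mxE /=; case: (f 1%:M) => u v.
  by case: (i == j); apply: complex_eq => /=; ring.
- have E : pi_hgl kappa c (hgl_elt R (genL i j) + hgl_elt R (genR i j))
      (fun x : M => (f x)^*) 1%:M = 0.
    rewrite pi_hgl_eltD genLE genRE /mulx.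
    under eq_bigr do rewrite mxE eq_sym; rewrite delta.
    under eq_bigr do rewrite mxE; rewrite delta.
    by ring.
  by rewrite E conjc0 oppr0.
Qed.

Lemma hecke_baxter_pairing (s : R[i]) (g : M) :
  s = 'i%C * kappa%:C + 1 / 2 ->
  hecke_baxter s c g = pairing psi (pi_gl kappa 1%:M g phi).
Proof.
move=> ->; rewrite /pairing /psi /conj_fun conjcK /pi_gl /hecke_baxter.
rewrite invmx1 !mul1mx; congr (cpow _ _ * _).
by rewrite -addrA -mulrDl [1 + _]addrC natr1.
Qed.

End Vectors.

Theorem theorem4p1 (R : realType) (l : nat) (kappa c : R) (hc : 0 < c) :
  [/\ is_hgl_module (pi_hgl (l := l) kappa c),
      is_GLxGL_module (pi_gl (l := l) kappa),
      integrates (pi_hgl (l := l) kappa c) (pi_gl (l := l) kappa)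
    & forall (g1 g2 : 'M[R]_l.+1) (f : 'M[R]_l.+1 -> R[i]) (x : 'M[R]_l.+1),
        g1 \in unitmx -> g2 \in unitmx ->
        pi_gl kappa g1 g2 f x = pi_kappa kappa g1 g2 * pi_gl 0 g1 g2 f x] /\
  [/\ schwartz (spherical_vector (l := l) c),
      is_spherical (pi_hgl kappa c) (spherical_vector (l := l) c),
      tempered (@whittaker_vector R l)
    & is_whittaker (pi_hgl_dual kappa c) (@whittaker_vector R l)] /\
  forall (s : R[i]) (g : 'M[R]_l.+1),
    s = 'i%C * kappa%:C + 1 / 2 -> g \in unitmx ->
    schwartz (pi_gl kappa 1%:M g (spherical_vector c)) /\
    hecke_baxter s c g =
      pairing (@whittaker_vector R l) (pi_gl kappa 1%:M g (spherical_vector c)).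
Proof.
have sphi := schwartz_spherical_vector l hc.
split; [split|split; [split|move=> s g sE ug; split]].
- exact: is_hgl_module_pi_hgl.
- exact: is_GLxGL_module_pi_gl.
- exact: integrates_pi_gl.
- by move=> g1 g2 f x _ _; exact: pi_gl_twist.
- exact: sphi.
- exact: is_spherical_spherical_vector.
- exact: tempered_whittaker_vector.
- exact: is_whittaker_whittaker_vector.
- by apply: schwartz_pi_gl; rewrite ?unitmx1.
- exact: hecke_baxter_pairing.
Qed.
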